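(* Let $k\ge2$ and $\mathcal X\subset\mathbb R^n$ open. Any scalar degenerate neural ODE $\Phi\in\mathrm{NODE}^k_{\mathrm D}(\mathcal X,\mathbb R)$ has only degenerate critical points, i.e. $\Phi$ is of class $(\mathcal C1)^k(\mathcal X,\mathbb R)$ or $(\mathcal C3)^k(\mathcal X,\mathbb R)$.
   Context: Neural ODE setting. Let $T>0$. Consider the initial value problem $\frac{\mathrm dh}{\mathrm dt}=f(t,h(t))$, $h(0)=a$, with $f:\Omega\to\mathbb R^m$, $\Omega=\Omega_t\times\Omega_h\subset\mathbb R\times\mathbb R^m$ open, with solution $h_a:\mathcal I_a\to\mathbb R^m$ on its maximal (open) interval of existence $\mathcal I_a\subset\Omega_t$. For $k\ge1$, $\mathrm{NODE}^k(\mathcal X,\mathbb R)$ is the set of all maps $\Phi:\mathcal X\to\mathbb R$, $\Phi(x)=\widetilde W\,h_{Wx+b}(T)+\tilde b$, with $W\in\mathbb R^{m\times n}$, $b\in\mathbb R^m$, $\widetilde W\in\mathbb R^{1\times m}$, $\tilde b\in\mathbb R$, with $f\in C^{0,k}(\Omega,\mathbb R^m)$ (continuous in $t$, $k$ times continuously differentiable in $h$), such that $\mathcal A=\{Wx+b:x\in\mathcal X\}\subset\Omega_h$ and $[0,T]\subset\mathcal I_a$ for all $a\in\mathcal A$. The neural ODE is degenerate if $\operatorname{rank}(W)<\min\{m,n\}$ or $\operatorname{rank}(\widetilde W)=0$; $\mathrm{NODE}^k_{\mathrm D}(\mathcal X,\mathbb R)$ is the set of these. A critical point is degenerate if the Hessian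 there is singular. $(\mathcal C1)^k(\mathcal X,\mathbb R)$: $C^k$ functions with no critical point. $(\mathcal C3)^k(\mathcal X,\mathbb R)$ ($k\ge2$): $C^k$ functions with at least one degenerate critical point. *)

(* Defs.v *)
From HB Require Import structures.
From mathcomp Require Import all_boot all_order all_algebra.
From mathcomp Require Import all_classical all_reals all_analysis.

Set Implicit Arguments.
Unset Strict Implicit.
Unset Printing Implicit Defensive.

Import Order.TTheory GRing.Theory Num.Theory.
Import numFieldNormedType.Exports.

Local Open Scope classical_set_scope.
Local Open Scope ring_scope.

(* Maps defined on a subset (of R^n, of R x R^m) are represented by total
   functions; every definition below only constrains them on that subset, which
   is open, so that limits and derivatives do not see the values outside. *)

(* In finite dimension x |-> 'd f x is C^k as a map into the space of linear
   maps iff x |-> 'd f x v is C^k for every direction v. *)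
Fixpoint Ck (R : realType) (V W : normedModType R) (U : set V) (k : nat)
    (f : V -> W) : Prop :=
  match k with
  | 0%N => forall x, U x -> {for x, continuous f}
  | k'.+1 => (forall x, U x -> differentiable f x) /\
             (forall v : V, Ck U k' (fun x => 'd f x v))
  end.

(* C^{0,k}: all derivatives in the second variable up to order k exist and are
   continuous jointly in both variables. *)
Fixpoint C0k (R : realType) (V W : normedModType R) (Omega : set (R * V))
    (k : nat) (f : R * V -> W) : Prop :=
  (forall z, Omega z -> {for z, continuous f}) /\
  match k with
  | 0%N => True
  | k'.+1 =>
      (forall t y, Omega (t, y) -> differentiable (fun h : V => f (t, h)) y) /\
      (forall v : V, C0k Omega k' (fun '(t, y) => 'd (fun h : V => f (t, h)) y v))
  end.

Definition ivp_solution (R : realType) (m : nat) (Ot : set R)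
    (Oh : set 'cV[R]_m) (f : R * 'cV[R]_m -> 'cV[R]_m) (a : 'cV[R]_m)
    (I : set R) (h : R -> 'cV[R]_m) : Prop :=
  [/\ open I, is_interval I, I 0, I `<=` Ot & h 0 = a] /\
  (forall t, I t -> Oh (h t) /\ is_derive t (1 : R) h (f (t, h t))).

Definition maximal_ivp_solution (R : realType) (m : nat) (Ot : set R)
    (Oh : set 'cV[R]_m) (f : R * 'cV[R]_m -> 'cV[R]_m) (a : 'cV[R]_m)
    (I : set R) (h : R -> 'cV[R]_m) : Prop :=
  ivp_solution Ot Oh f a I h /\
  (forall (J : set R) (g : R -> 'cV[R]_m), ivp_solution Ot Oh f a J g ->
     I `<=` J -> (forall t, I t -> g t = h t) -> J = I).

(* [Ia a] and [h a] are the maximal interval of existence and the maximal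
   solution with initial value [a]. *)
Definition node_repr (R : realType) (k : nat) (T : R) (n m : nat)
    (X : set 'cV[R]_n) (Ot : set R) (Oh : set 'cV[R]_m)
    (f : R * 'cV[R]_m -> 'cV[R]_m) (W : 'M[R]_(m, n)) (b : 'cV[R]_m)
    (Wt : 'M[R]_(1, m)) (bt : R) (Phi : 'cV[R]_n -> R) : Prop :=
  [/\ open Ot, open Oh, C0k (Ot `*` Oh) k f,
      (forall x, X x -> Oh (W *m x + b)) &
      exists (Ia : 'cV[R]_m -> set R) (h : 'cV[R]_m -> R -> 'cV[R]_m),
        forall x, X x ->
          [/\ maximal_ivp_solution Ot Oh f (W *m x + b)
                (Ia (W *m x + b)) (h (W *m x + b)),
              `[0, T]%classic `<=` Ia (W *m x + b) &
              Phi x = (Wt *m h (W *m x + b) T) 0 0 + bt]].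

Definition degenerate_weights (R : realType) (n m : nat) (W : 'M[R]_(m, n))
    (Wt : 'M[R]_(1, m)) : Prop :=
  (\rank W < minn m n)%N \/ \rank Wt = 0%N.

Definition NODE_D (R : realType) (k : nat) (T : R) (n : nat)
    (X : set 'cV[R]_n) (Phi : 'cV[R]_n -> R) : Prop :=
  exists (m : nat) (Ot : set R) (Oh : set 'cV[R]_m)
    (f : R * 'cV[R]_m -> 'cV[R]_m) (W : 'M[R]_(m, n)) (b : 'cV[R]_m)
    (Wt : 'M[R]_(1, m)) (bt : R),
    [/\ (0 < m)%N, node_repr k T X Ot Oh f W b Wt bt Phi &
        degenerate_weights W Wt].

Definition partial (R : realType) (n : nat) (i : 'I_n)
    (Phi : 'cV[R]_n -> R) (x : 'cV[R]_n) : R :=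
  'D_(delta_mx i 0 : 'cV[R]_n) Phi x.

Definition gradient (R : realType) (n : nat) (Phi : 'cV[R]_n -> R)
    (x : 'cV[R]_n) : 'cV[R]_n :=
  \col_i partial i Phi x.

Definition hessian (R : realType) (n : nat) (Phi : 'cV[R]_n -> R)
    (x : 'cV[R]_n) : 'M[R]_n :=
  \matrix_(i, j) partial i (partial j Phi) x.

Definition critical_point (R : realType) (n : nat) (X : set 'cV[R]_n)
    (Phi : 'cV[R]_n -> R) (x : 'cV[R]_n) : Prop :=
  X x /\ gradient Phi x = 0.

Definition degenerate_critical_point (R : realType) (n : nat)
    (X : set 'cV[R]_n) (Phi : 'cV[R]_n -> R) (x : 'cV[R]_n) : Prop :=
  critical_point X Phi x /\ hessian Phi x \notin unitmx.

Definition class_C1 (R : realType) (n : nat) (k : nat) (X : set 'cV[R]_n)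
    (Phi : 'cV[R]_n -> R) : Prop :=
  Ck X k Phi /\ ~ (exists x, critical_point X Phi x).

Definition class_C3 (R : realType) (n : nat) (k : nat) (X : set 'cV[R]_n)
    (Phi : 'cV[R]_n -> R) : Prop :=
  Ck X k Phi /\ (exists x, degenerate_critical_point X Phi x).

(* Main.v *)
(* The endpoint of the flow of a C^{0,k} field is a C^k function of the initial
   value.  Solutions are only known to exist along x |-> W x + b, so instead of
   solving the variational equation we compare difference quotients: along a
   fixed trajectory f(t, .) is strictly differentiable uniformly in t, hence by
   Gronwall two increments of the flow coming from collinear increments of x
   agree up to o(|x - x'|), which yields strict differentiability in x.  The
   uniform limit of the difference quotients solves the variational equation,
   and the pair (solution, variation) is the flow of an augmented C^{0,k-1}
   field, so that induction on k applies.
   Degenerate weights leave Phi invariant along a fixed direction v <> 0: a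
   vector of the kernel of W, or any vector when the output weights vanish.
   Then 'd Phi _ v = 0 on the open set X, and differentiating once more shows
   that v is in the kernel of the Hessian. *)
Require Import Defs.
From HB Require Import structures.
From mathcomp Require Import all_boot all_order all_algebra.
From mathcomp Require Import all_classical all_reals all_analysis.
From mathcomp Require Import ring lra.

Import Order.TTheory GRing.Theory Num.Theory.
Import numFieldNormedType.Exports.
Local Open Scope classical_set_scope.
Local Open Scope ring_scope.

Set Implicit Arguments.
Unset Strict Implicit.
Unset Printing Implicit Defensive.

(** [NODE_D] asserts nothing about the regularity of [Phi], yet both classes demand [Ck]; nearly all
    the work lies there. When the rank of [W] is below [m], the initial values fill only part of a
    proper affine subspace, so the flow is differentiated with respect to the parameter [x] and not
    the initial value. The link kept between the two is that differences of initial values are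
    [L (p - q)] with [L] linear, a condition that survives the passage to the augmented system,
    whose initial value is [(y x 0, L v)]. The field is merely continuous in time, so derivatives
    are taken at frozen [t], and uniformity in [t] comes from compactness of [[0, T]]. The induction
    on [k] leaves column vectors for iterated products, hence the setting of normed modules with
    finitely many coordinate forms; through them convergence, mean values and operator bounds reduce
    to real-valued statements. *)

Lemma linear_pack (R : realType) (V W : normedModType R) (f : V -> W) :
  linear f -> exists g : {linear V -> W}, g = f :> (V -> W).
Proof.
move=> lf; pose b := GRing.isLinear.Build R V W *:%R f lf.
by pose g : {linear V -> W} := HB.pack f b; exists g.
Qed.

(** * Epsilon-delta forms of continuity and differentiability *)

Section EpsilonDelta.
Context (R : realType).
Implicit Types (V W : normedModType R).

Lemma near_normP V (x : V) (P : V -> Prop) :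
  (\near x, P x) <-> exists2 d : R, 0 < d & forall p, `|p - x| < d -> P p.
Proof.
split.
  by move=> /nbhs_normP[d /= d0 H]; exists d => // p px; apply: H; rewrite /= distrC.
move=> [d d0 H]; apply/nbhs_normP; exists d => //= p; rewrite /= distrC; exact: H.
Qed.

Lemma continuous_normP V W (F : V -> W) (x : V) : {for x, continuous F} <->
  forall e : R, 0 < e ->
    exists2 d : R, 0 < d & forall p, `|p - x| < d -> `|F p - F x| < e.
Proof.
rewrite /continuous_at; split.
  by move=> /cvgrPdistC_lt H e /H /near_normP.
by move=> H; apply/cvgrPdistC_lt => e /H /near_normP.
Qed.

Lemma within_normP V W (A : set V) (F : V -> W) : {within A, continuous F} <->
  forall x, A x -> forall e : R, 0 < e -> exists2 d : R, 0 < d &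
    forall p, A p -> `|p - x| < d -> `|F p - F x| < e.
Proof.
split.
  move=> /subspace_continuousP H x Ax e e0.
  have /cvgrPdistC_lt/(_ e e0) := H x Ax.
  rewrite near_withinE => /near_normP[d d0 Hd].
  by exists d => // p Ap px; apply: Hd.
move=> H; apply/subspace_continuousP => x Ax; apply/cvgrPdistC_lt => e e0.
have [d d0 Hd] := H x Ax e e0.
rewrite near_withinE; apply/near_normP; exists d => // p px Ap; exact: Hd.
Qed.

Lemma diff_normP V W (F : V -> W) (x : V) : differentiable F x ->
  forall e : R, 0 < e -> exists2 d : R, 0 < d &
    forall p, `|p - x| < d -> `|F p - F x - 'd F x (p - x)| <= e * `|p - x|.
Proof.
move=> /diff_locally /eqaddoP H e e0.
have /near_normP[d d0 Hd] := H e e0.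
exists d => // p px; have := Hd (p - x); rewrite subr0 => /(_ px).
by rewrite /= !fctE /= subrK opprD addrA.
Qed.

Lemma diff_normI V W (F : V -> W) (x : V) (u : {linear V -> W}) :
  continuous u ->
  (forall e : R, 0 < e -> exists2 d : R, 0 < d &
    forall p, `|p - x| < d -> `|F p - F x - u (p - x)| <= e * `|p - x|) ->
  differentiable F x /\ 'd F x = u :> (V -> W).
Proof.
move=> cu H.
have E : F \o shift x = cst (F x) + u +o_ (0 : V) id.
  apply/eqaddoP => e e0; have [d d0 Hd] := H e e0.
  apply/near_normP; exists d => // h; rewrite subr0 => hd.
  have := Hd (h + x); rewrite addrK => /(_ hd).
  by rewrite /= !fctE /= opprD addrA.
have dE := diff_unique cu E.
by split=> //; apply/diff_locallyP; rewrite dE.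
Qed.

Lemma is_derive_normP W (w : R -> W) (t : R) (d : W) : is_derive t 1 w d <->
  forall e : R, 0 < e -> exists2 r : R, 0 < r &
    forall s, `|s - t| < r -> `|w s - w t - (s - t) *: d| <= e * `|s - t|.
Proof.
split.
  move=> [/derivable1_diffP dw wd] e e0.
  have [r r0 Hr] := diff_normP dw e0; exists r => // s sr.
  have := Hr s sr; rewrite -wd deriveE // -linearZ /=.
  by rewrite /GRing.scale /= mulr1.
move=> H; have [u uE] : exists u : {linear R -> W}, u = ( *:%R^~ d) :> (R -> W).
  by apply: linear_pack => a x y /=; rewrite scalerDl scalerA.
have cu : continuous u by rewrite uE => x; apply: scalel_continuous.
have [|dw dE] := diff_normI (F := w) (x := t) cu.
  by move=> e /H[r r0 Hr]; exists r => // p; rewrite uE; apply: Hr.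
split; first exact/derivable1_diffP.
by rewrite deriveE // dE uE scale1r.
Qed.

Lemma linear_continuous_bound V W (u : {linear V -> W}) : continuous u <->
  exists2 K : R, 0 < K & forall v, `|u v| <= K * `|v|.
Proof.
split.
  move=> /linear_bounded_continuous/linear_boundedP H.
  near (+oo : set_system R) => K; exists K; first by [].
  by near: K.
move=> [K K0 HK] x; apply/continuous_normP => e e0.
exists (e / K); first by rewrite divr_gt0.
move=> p px; rewrite -linearB (le_lt_trans (HK _)) // mulrC.
by rewrite -ltr_pdivlMr.
Unshelve. all: by end_near. Qed.

Lemma is_derive_linear V W (u : {linear V -> W}) (w : R -> V) (t : R) (d : V) :
  continuous u -> is_derive t 1 w d -> is_derive t 1 (u \o w) (u d).
Proof.
move=> /linear_continuous_bound[K K0 HK] /is_derive_normP H.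
apply/is_derive_normP => e e0; have [|r r0 Hr] := H (e / K).
  by rewrite divr_gt0.
exists r => // s sr /=; rewrite -linearZ -!linearB (le_trans (HK _)) //.
by rewrite mulrC -ler_pdivlMr // mulrAC Hr.
Qed.

End EpsilonDelta.

(* The coordinate forms need not be dual to the vectors. Since the norm is
   exactly the sup of the coordinates, scalar mean value estimates lift without
   loss of constants, and such coordinates exist on products. *)
Record sup_coords (R : realType) (V : normedModType R) := SupCoords {
  sc_idx : finType;
  sc_crd : sc_idx -> {linear V -> R};
  sc_vec : sc_idx -> V;
  sc_sum : forall v, v = \sum_i sc_crd i v *: sc_vec i;
  sc_le : forall i v, `|sc_crd i v| <= `|v|;
  sc_sup : forall v (M : R), 0 <= M -> (forall i, `|sc_crd i v| <= M) -> `|v| <= M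
}.

Arguments sc_crd {R V} s i.
Arguments sc_vec {R V} s i.
Arguments sc_sum {R V} s v.
Arguments sc_le {R V} s i v.
Arguments sc_sup {R V} s v M.

(** * Mean value inequalities and Gronwall's lemma *)

Section MeanValue.
Context (R : realType).
Implicit Types (V : normedModType R) (a b : R).

Lemma within_linear V (W : normedModType R) (u : {linear V -> W})
    (w : R -> V) (A : set R) :
  continuous u -> {within A, continuous w} -> {within A, continuous (u \o w)}.
Proof.
move=> cu cw x; apply: (@continuous_comp (subspace A) V W w u x (cw x)).
exact: cu.
Qed.

Lemma sc_continuous V (C : sup_coords V) i : continuous (sc_crd C i).
Proof.
apply/linear_continuous_bound; exists 1 => // v; rewrite mul1r; exact: sc_le.
Qed.

Lemma le_increment (phi psi dphi dpsi : R -> R) a b : a <= b ->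
  {within `[a, b], continuous phi} -> {within `[a, b], continuous psi} ->
  (forall t, t \in `]a, b[ -> is_derive t (1 : R) phi (dphi t)) ->
  (forall t, t \in `]a, b[ -> is_derive t (1 : R) psi (dpsi t)) ->
  (forall t, t \in `]a, b[ -> dphi t <= dpsi t) ->
  phi b - phi a <= psi b - psi a.
Proof.
rewrite le_eqVlt => /predU1P[->|ab] cphi cpsi Dphi Dpsi le_d; first by rewrite !subrr.
have D t : t \in `]a, b[ -> is_derive t (1 : R) (phi - psi) ((dphi - dpsi) t).
  by move=> t_in; apply: is_deriveB; [exact: Dphi|exact: Dpsi].
have cont : {within `[a, b], continuous (phi - psi)}.
  by move=> x; apply: cvgB; [exact: cphi|exact: cpsi].
have [t t_in E] := MVT ab D cont.
have : (phi - psi) b - (phi - psi) a <= 0.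
  rewrite E !fctE /= pmulr_lle0 ?subr_gt0 // subr_le0; exact: le_d.
by rewrite !fctE /=; lra.
Qed.

(** A vector-valued curve has no mean value point; each coordinate and its opposite are compared
    with [psi] by [le_increment], and the sup property reassembles the norm. *)
Lemma norm_le_increment V (C : sup_coords V) (w dw : R -> V) (psi dpsi : R -> R)
    a b : a <= b ->
  {within `[a, b], continuous w} -> {within `[a, b], continuous psi} ->
  (forall t, t \in `]a, b[ -> is_derive t (1 : R) w (dw t)) ->
  (forall t, t \in `]a, b[ -> is_derive t (1 : R) psi (dpsi t)) ->
  (forall t, t \in `]a, b[ -> `|dw t| <= dpsi t) ->
  `|w b - w a| <= psi b - psi a.
Proof.
move=> ab cw cpsi Dw Dpsi le_d.
have Dc i t : t \in `]a, b[ -> is_derive t (1 : R) (sc_crd C i \o w) (sc_crd C i (dw t)).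
  by move=> /Dw; apply: is_derive_linear; exact: sc_continuous.
have cc i : {within `[a, b], continuous (sc_crd C i \o w)}.
  by apply: within_linear => //; exact: sc_continuous.
apply: (sc_sup C) => [|i].
  (* [sc_sup] asks for a nonnegative bound, since the index type may be empty; it comes from
     comparing the zero function with [psi]. *)
  rewrite -[leLHS](subrr 0).
  apply: (@le_increment (cst 0) psi (cst 0) dpsi) => //.
  - by apply: continuous_subspaceT; exact: cst_continuous.
  - by move=> t t_in; apply: le_trans (le_d t t_in).
rewrite linearB ler_norml; apply/andP; split; last first.
  apply: (le_increment ab (cc i) cpsi (Dc i) Dpsi) => t t_in.
  by apply: le_trans (le_d _ t_in); apply: le_trans (ler_norm _) (sc_le _ _ _).
have cNc : {within `[a, b], continuous (- (sc_crd C i \o w))}.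
  by move=> x; apply: cvgN; exact: cc.
have DNc t : t \in `]a, b[ ->
    is_derive t (1 : R) (- (sc_crd C i \o w)) (- sc_crd C i (dw t)).
  by move=> t_in; apply: is_deriveN; exact: Dc.
rewrite lerNl opprB -[leLHS]addrC -[X in _ + X <= _]opprK.
apply: (le_increment ab cNc cpsi DNc Dpsi) => t t_in.
apply: le_trans (le_d _ t_in); apply: le_trans (sc_le C i _).
by rewrite -normrN ler_norm.
Qed.

Lemma norm_le_increment_cst V (C : sup_coords V) (w dw : R -> V) (M a b : R) :
  a <= b -> {within `[a, b], continuous w} ->
  (forall t, t \in `]a, b[ -> is_derive t (1 : R) w (dw t)) ->
  (forall t, t \in `]a, b[ -> `|dw t| <= M) ->
  `|w b - w a| <= M * (b - a).
Proof.
move=> ab cw Dw le_M.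
have DM t : is_derive t (1 : R) (fun s : R => M * s) M.
  apply/is_derive_normP => e e0; exists 1 => // s _.
  by rewrite -mulrBr /GRing.scale /= mulrC subrr normr0 mulr_ge0 // ltW.
have cM : {within `[a, b], continuous (fun s : R => M * s)}.
  by apply: continuous_subspaceT; exact: mulrl_continuous.
have := norm_le_increment C (dpsi := fun=> M) ab cw cM Dw (fun t _ => DM t) le_M.
by rewrite mulrBr.
Qed.

(* The bound is obtained at a maximum point of [|w t| * exp (- 2 K t)]. *)
Lemma gronwall V (C : sup_coords V) (w dw : R -> V) (T K eta : R) :
  0 <= T -> 0 < K -> 0 <= eta ->
  {within `[0, T], continuous w} ->
  (forall t, t \in `]0, T[ -> is_derive t (1 : R) w (dw t)) ->
  (forall t, t \in `]0, T[ -> `|dw t| <= K * `|w t| + eta) ->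
  forall t, t \in `[0, T] ->
    `|w t| <= 2 * expR (2 * K * T) * (`|w 0| + eta * T).
Proof.
move=> T0 K0 eta0 cw Dw le_dw.
have cexp a : continuous (fun s : R => expR (a * s)).
  move=> s; apply: continuous_comp; first exact: mulrl_continuous.
  exact: continuous_expR.
have cg : {within `[0, T], continuous (fun t => `|w t| * expR (- (2 * K) * t))}.
  move=> x; apply: cvgM; first by apply: cvg_norm; exact: cw.
  by apply: continuous_subspaceT; exact: cexp.
have [s s_in max_s] := EVT_max T0 cg.
set M := `|w s| * _ in max_s.
have M0 : 0 <= M by rewrite mulr_ge0 // expR_ge0.
have w_le t : t \in `[0, T] -> `|w t| <= M * expR (2 * K * t).
  move=> /max_s; rewrite mulNr expRN => H.
  by rewrite -ler_pdivrMr ?expR_gt0.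
have ws : `|w s| = M * expR (2 * K * s).
  by rewrite /M mulNr expRN -mulrA mulVf ?mulr1 // gt_eqF ?expR_gt0.
have /andP[s0 sT] : 0 <= s <= T by rewrite in_itv in s_in.
(* By [w_le], [dpsi] dominates the norm of [dw]. Integrating an exponential of rate [2 * K] produces
   the factor [M / 2], so the exponential part of [psi s - psi 0] is at most half of
   [|w s| = M * expR (2 * K * s)]; the rest is paid for by [w 0] and [eta]. *)
pose psi t := M / 2 * expR (2 * K * t) + eta * t.
pose dpsi t := K * (M * expR (2 * K * t)) + eta.
have Dpsi t : is_derive t (1 : R) psi (dpsi t).
  rewrite /psi /dpsi.
  have De : is_derive t (1 : R) (fun s => 2 * K * s) (2 * K).
    have := @is_deriveZ _ _ _ id (2 * K) t 1 1 (is_derive_id _ _).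
    by rewrite /GRing.scale /= mulr1.
  have D1 : is_derive t (1 : R) (fun s => expR (2 * K * s))
      (2 * K * expR (2 * K * t)).
    have := @is_derive1_comp R expR (fun s => 2 * K * s) t _ _ (is_derive_expR _) De.
    by move=> D; apply: is_derive_eq D _; rewrite mulrC.
  have D2 : is_derive t (1 : R) (fun s => eta * s) eta.
    have := @is_deriveZ _ _ _ id eta t 1 1 (is_derive_id _ _).
    by rewrite /GRing.scale /= mulr1.
  have := is_deriveD (@is_deriveZ _ _ _ _ (M / 2) t 1 _ D1) D2.
  by move=> D; apply: is_derive_eq D _; rewrite /GRing.scale /=; field.
have inc : `|w s - w 0| <= psi s - psi 0.
  have cws : {within `[0, s], continuous w}.
    apply: continuous_subspaceW cw => t /=; rewrite !in_itv /= => /andP[-> ts].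
    exact: le_trans ts sT.
  have cpsi : {within `[0, s], continuous psi}.
    apply: continuous_subspaceT => t; apply: differentiable_continuous.
    by apply/derivable1_diffP; case: (Dpsi t).
  have sub_in t : t \in `]0, s[ -> t \in `]0, T[.
    by rewrite !in_itv /= => /andP[-> /lt_le_trans->].
  have le_dpsi t : t \in `]0, s[ -> `|dw t| <= dpsi t.
    move=> /sub_in t_in; apply: le_trans (le_dw t t_in) _.
    rewrite /dpsi lerD2r; apply: ler_wpM2l; first exact: ltW.
    by apply: w_le; exact: subset_itv_oo_cc.
  exact: (norm_le_increment C s0 cws cpsi (fun t H => Dw t (sub_in t H))
    (fun t _ => Dpsi t) le_dpsi).
have le1 : 1 <= expR (2 * K * s).
  by rewrite -expR0 ler_expR mulr_ge0 // mulr_ge0 // ltW.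
have M_le : M <= 2 * (`|w 0| + eta * T).
  have E : eta * s <= eta * T by rewrite ler_wpM2l.
  have := le_trans (lerB_dist (w s) (w 0)) inc.
  rewrite ws /psi !mulr0 expR0 => H.
  have : M <= M * expR (2 * K * s) by rewrite ler_peMr.
  lra.
move=> t t_in; apply: le_trans (w_le t t_in) _.
rewrite [leRHS]mulrAC; apply: ler_pM => //.
rewrite ler_expR; apply: ler_wpM2l; first by rewrite mulr_ge0 // ltW.
by move: t_in; rewrite in_itv => /andP[].
Qed.

End MeanValue.

(** * Estimates near a trajectory, uniform in time *)

Section Tube.
Context (R : realType).
Implicit Types (V W : normedModType R).

(** An operator norm bound by finitely many evaluations. [C0k] controls differentials in fixed
    directions; this turns such control into estimates uniform in the direction. *)
Lemma sum_coord_bound V W (C : sup_coords V) (D : {linear V -> W}) v :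
  `|D v| <= (\sum_i `|D (sc_vec C i)|) * `|v|.
Proof.
rewrite {1}(sc_sum C v) linear_sum mulr_suml.
apply: le_trans (ler_norm_sum _ _ _) _; apply: ler_sum => i _.
by rewrite linearZ normrZ mulrC ler_wpM2l // sc_le.
Qed.

Lemma sum_coord_boundB V W (C : sup_coords V) (D D' : {linear V -> W}) v :
  `|D v - D' v| <= (\sum_i `|D (sc_vec C i) - D' (sc_vec C i)|) * `|v|.
Proof.
have [E EE] : exists E : {linear V -> W}, E = (fun v => D v - D' v) :> (V -> W).
  apply: linear_pack => a x y /=.
  by rewrite !linearD !linearZ /= addrACA.
by have := sum_coord_bound C E v; rewrite EE.
Qed.

Lemma is_derive_segment V W (F : V -> W) (q u : V) (s : R) :
  differentiable F (q + s *: u) ->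
  is_derive s (1 : R) (fun s : R => F (q + s *: u)) ('d F (q + s *: u) u).
Proof.
move=> dF; apply/is_derive_normP => e e0.
have u1 : 0 < `|u| + 1 by rewrite ltr_wpDl.
have [|d d0 Hd] := diff_normP dF (e := e / (`|u| + 1)); first by rewrite divr_gt0.
exists (d / (`|u| + 1)); first by rewrite divr_gt0.
move=> r rs; have E : (q + r *: u) - (q + s *: u) = (r - s) *: u.
  by rewrite opprD addrACA subrr add0r scalerBl.
have le1 : `|r - s| * `|u| <= `|r - s| * (`|u| + 1) by rewrite ler_wpM2l // lerDl.
have := Hd (q + r *: u); rewrite E linearZ normrZ /= => H.
apply: le_trans (H _) _.
  by rewrite (le_lt_trans le1) // -ltr_pdivlMr.
apply: le_trans (ler_wpM2l _ le1) _; first by rewrite ltW // divr_gt0.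
by rewrite mulrCA mulrA -[_ * _ * (_ + 1)]mulrA divfK ?gt_eqF // mulrC.
Qed.

Lemma continuous_sum V W (I : finType) (F : I -> V -> W) (x : V) :
  (forall i, {for x, continuous (F i)}) ->
  {for x, continuous (fun y => \sum_i F i y)}.
Proof.
move=> cF; elim: (index_enum I) => [|i r IHr].
  rewrite (_ : (fun _ => _) = cst 0); first exact: cst_continuous.
  by apply/funext => y; rewrite big_nil.
rewrite (_ : (fun _ => _) = (fun y => F i y + \sum_(j <- r) F j y)).
  by apply: continuousD; [exact: cF|exact: IHr].
by apply/funext => y; rewrite big_cons.
Qed.

Lemma C0k1P V W (Om : set (R * V)) (f : R * V -> W) : C0k Om 1 f ->
  [/\ forall z, Om z -> {for z, continuous f},
      forall t y, Om (t, y) -> differentiable (fun h : V => f (t, h)) y &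
      forall v z, Om z ->
        {for z, continuous (fun z : R * V => 'd (fun h : V => f (z.1, h)) (z.2) v)}].
Proof.
move=> [cf [df cdf]]; split=> // v z Oz; have [+ _] := cdf v.
move=> /(_ z Oz); rewrite (_ : (fun '(_, _) => _) =
  (fun z : R * V => 'd (fun h : V => f (z.1, h)) (z.2) v)) //.
by apply/funext => -[].
Qed.

Section Trajectory.
Context (V : normedModType R) (T : R) (Om : set (R * V)) (g : R -> V).
Hypotheses (T0 : 0 <= T) (oOm : open Om) (cg : {within `[0, T], continuous g})
  (gOm : forall t, t \in `[0, T] -> Om (t, g t)).

Lemma trajectory_cvg t : t \in `[0, T] ->
  forall e : R, 0 < e -> exists2 d : R, 0 < d & forall s, s \in `[0, T] ->
    `|s - t| < d -> forall p, `|p - g s| < d -> `|(s, p) - (t, g t)| < e.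
Proof.
move=> t_in e e0; have e20 : 0 < e / 2 by rewrite divr_gt0.
move/within_normP: cg => /(_ t t_in (e / 2) e20)[d d0 Hd].
exists (Num.min d (e / 2)); first by rewrite lt_min d0 e20.
move=> s s_in; rewrite lt_min => /andP[sd se] p; rewrite lt_min => /andP[_ pe].
rewrite prod_normE /= gt_max; apply/andP; split; first lra.
by have := ler_distD (g s) p (g t); have := Hd s s_in sd; lra.
Qed.

Lemma continuous_trajectory W (G : R * V -> W) :
  (forall z, Om z -> {for z, continuous G}) ->
  {within `[0, T], continuous (fun t => G (t, g t))}.
Proof.
move=> cG; apply/within_normP => t t_in e e0.
have /continuous_normP/(_ e e0)[d d0 Hd] := cG _ (gOm t_in).
have [r r0 Hr] := trajectory_cvg t_in d0.
exists r => // s s_in sr; apply: Hd; apply: Hr => //.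
by rewrite subrr normr0.
Qed.

Lemma bounded_trajectory W (G : R * V -> W) :
  (forall z, Om z -> {for z, continuous G}) ->
  exists M : R, forall t, t \in `[0, T] -> `|G (t, g t)| <= M.
Proof.
move=> /continuous_trajectory cG.
have cn : {within `[0, T], continuous (fun t => `|G (t, g t)|)}.
  by move=> x; apply: cvg_norm; exact: cG.
by have [s _ Hs] := EVT_max T0 cn; exists `|G (s, g s)|.
Qed.

(** Compactness of [[0, T]] in near-covering form makes the radius independent of [t]. The
    conclusion holds for all small [d], so that finitely many tubes can be intersected. The
    tolerance is halved because [(t, p)] and [(t, g t)] are both compared with the centre of a
    covering piece. *)
Lemma tube W (G : R * V -> W) (e : R) : 0 < e ->
  (forall z, Om z -> {for z, continuous G}) ->
  \forall d \near (0 : R)^'+, forall t, t \in `[0, T] -> forall p, `|p - g t| < d ->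
    Om (t, p) /\ `|G (t, p) - G (t, g t)| < e.
Proof.
move=> e0 cG.
have e20 : 0 < e / 2 by rewrite divr_gt0.
have ncov := (compact_near_coveringP _).1 (@segment_compact R 0 T).
pose P (d t : R) := t \in `[0, T] -> forall p, `|p - g t| < d ->
    Om (t, p) /\ `|G (t, p) - G (t, g t)| < e.
suff : \forall d \near (0 : R)^'+, `[0, T]%classic `<=` P d.
  by apply: filterS => d Hd t t_in; exact: Hd.
apply: ncov => t t_in.
have Omt := gOm t_in.
have /continuous_normP/(_ _ e20)[d1 d10 H1] := cG _ Omt.
have nOm : nbhs (t, g t) Om by exact: open_nbhs_nbhs.
have [d2 d20 H2] := (@near_normP R (R * V)%type (t, g t) Om).1 nOm.
have d0 : 0 < Num.min d1 d2 by rewrite lt_min d10 d20.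
have [r r0 Hr] := trajectory_cvg t_in d0.
exists ([set s : R | `|s - t| < r], [set d : R | d < r]) => /=.
  split; first by apply: (@near_normP R R t _).2; exists r.
  exact: nbhs_right_lt.
move=> [s d] /= [st dr] s_in p pd.
have := Hr s s_in st p (lt_trans pd dr); rewrite lt_min => /andP[pd1 pd2].
have := Hr s s_in st (g s); rewrite subrr normr0 r0 lt_min => /(_ isT)/andP[gd1 _].
split; first exact: H2.
have := H1 _ pd1; have := H1 _ gd1.
have := ler_distD (G (t, g t)) (G (s, p)) (G (s, g s)).
by rewrite (distrC (G (t, g t))); lra.
Qed.

Section C01.
Context (f : R * V -> V) (C : sup_coords V).
Hypothesis Cf : C0k Om 1 f.

Local Notation Df t p := ('d (fun h : V => f (t, h)) p).

Lemma diff_bounded :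
  exists2 K : R, 0 < K & forall t, t \in `[0, T] -> forall v, `|Df t (g t) v| <= K * `|v|.
Proof.
have [cf df cdf] := C0k1P Cf.
(* A continuous majorant of the operator norm of [Df]. *)
pose G (z : R * V) : R := \sum_i `|Df z.1 z.2 (sc_vec C i)|.
have cG z : Om z -> {for z, continuous G}.
  move=> Oz; apply: continuous_sum => i; apply: cvg_norm; exact: cdf.
have [M HM] := bounded_trajectory cG.
exists (`|M| + 1); first by rewrite ltr_wpDl.
move=> t t_in v; apply: le_trans (sum_coord_bound C _ _) _.
apply: ler_wpM2r => //; have := HM t t_in.
have -> : G (t, g t) = \sum_i `|Df t (g t) (sc_vec C i)| by [].
rewrite ger0_norm ?sumr_ge0 // => H; have := ler_norm M; lra.
Qed.

(** Along the segment from [q] to [p], which stays in the ball by convexity, [f (t, .)] minus the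
    linear map [Df t (g t)] has as derivative a difference of two differentials. It is small inside
    a tube around [g], and the mean value inequality concludes. *)
Lemma strict_diff (e : R) : 0 < e ->
  exists2 d : R, 0 < d & forall t, t \in `[0, T] -> forall p q,
    `|p - g t| < d -> `|q - g t| < d ->
    `|f (t, p) - f (t, q) - Df t (g t) (p - q)| <= e * `|p - q|.
Proof.
move=> e0; have [cf df cdf] := C0k1P Cf.
(* Each coordinate direction receives the tolerance [e / N]; the extra 1 keeps [N] positive when
   there are no coordinates. *)
pose N : R := #|sc_idx C|%:R + 1.
have N0 : 0 < N by rewrite ltr_wpDl.
have eN0 : 0 < e / N by rewrite divr_gt0.
have HT i : \forall d \near (0 : R)^'+, forall t, t \in `[0, T] ->
    forall p, `|p - g t| < d -> Om (t, p) /\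
    `|Df t p (sc_vec C i) - Df t (g t) (sc_vec C i)| < e / N.
  have := tube eN0 (cdf (sc_vec C i)).
  by apply: filterS => d Hd t t_in p pd; exact: Hd.
have HO : \forall d \near (0 : R)^'+, forall t, t \in `[0, T] ->
    forall p, `|p - g t| < d -> Om (t, p).
  have := tube eN0 cf.
  by apply: filterS => d Hd t t_in p pd; have [] := Hd t t_in p pd.
have HT' := filter_forall (at_right_proper_filter (0 : R)) HT.
have [d [[d0 HOd] HTd]] :=
  filter_ex (filterI (filterI (nbhs_right_gt (0 : R)) HO) HT').
exists d => // t t_in p q pd qd.
pose z s := q + s *: (p - q).
have zd s : s \in `[0, 1] -> `|z s - g t| < d.
  rewrite in_itv /= => /andP[s0 s1].
  have -> : z s - g t = s *: (p - g t) + (1 - s) *: (q - g t).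
    have -> : z s = (q - g t + g t) + s *: ((p - g t) - (q - g t)).
      by rewrite subrK opprB addrA subrK.
    by rewrite addrAC addrK scalerBr addrCA scalerBl scale1r.
  apply: le_lt_trans (ler_normD _ _) _; rewrite !normrZ !ger0_norm ?subr_ge0 //.
  have : s * `|p - g t| <= s * Num.max `|p - g t| `|q - g t|.
    by rewrite ler_wpM2l // le_max lexx.
  have : (1 - s) * `|q - g t| <= (1 - s) * Num.max `|p - g t| `|q - g t|.
    by rewrite ler_wpM2l ?subr_ge0 // le_max lexx orbT.
  have : Num.max `|p - g t| `|q - g t| < d by rewrite gt_max pd qd.
  lra.
pose dw s := Df t (z s) (p - q) - Df t (g t) (p - q).
have zOm s : s \in `[0, 1] -> Om (t, z s) by move=> /zd /(HOd t t_in).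
have Dw (s : R) : s \in `[0, 1] -> is_derive s (1 : R)
    (fun s : R => f (t, z s) - s *: Df t (g t) (p - q)) (dw s).
  move=> /zOm Os; apply: is_deriveB.
    by apply: (@is_derive_segment _ _ (fun h : V => f (t, h))); exact: df.
  have := @is_derive_normP R V (fun s : R => s *: Df t (g t) (p - q)) s
    (Df t (g t) (p - q)).
  move=> [_]; apply => r r0; exists 1 => // u _.
  by rewrite scalerBl subrr normr0 mulr_ge0 // ltW.
have cw : {within `[0, 1], continuous (fun s : R => f (t, z s) - s *: Df t (g t) (p - q))}.
  apply/subspace_continuousP => s s_in; apply: cvg_within_filter.
  apply: differentiable_continuous; apply/derivable1_diffP.
  by case: (Dw s s_in).
have sub (s : R) : s \in `]0, 1[ -> s \in `[0, 1] by exact: subset_itv_oo_cc.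
have := norm_le_increment_cst C (M := e * `|p - q|) ler01 cw (fun (s : R) H => Dw s (sub s H)).
rewrite /z !scale1r !scale0r !addr0 !subr0 mulr1 [q + _]addrC subrK addrAC.
apply=> s s_in; apply: le_trans (sum_coord_boundB C _ _ _) _.
apply: ler_wpM2r => //.
apply: (@le_trans _ _ (\sum_(i : sc_idx C) e / N)).
  by apply: ler_sum => i _; have [_ /ltW] := HTd i t t_in _ (zd s (sub s s_in)).
rewrite sumr_const -mulr_natl mulrCA; apply: ler_piMr; first exact: ltW.
by rewrite ler_pdivrMr // mul1r lerDl.
Qed.

End C01.
End Trajectory.
End Tube.

(** * Strict differentiability without a candidate derivative *)

Section StrictDerivative.
Context (R : realType) (E V : normedModType R).
Implicit Types (F : E -> V) (x : E) (e d : R).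

(** A strict derivative [D] at [x] satisfies [D (p - q) = a *: D (p' - q')]; eliminating [D] leaves
    a condition on the values of [F] alone, which can be checked before any derivative is known to
    exist. *)
Definition collinear_approx F x e d := forall p q p' q' (a : R),
  `|p - x| < d -> `|q - x| < d -> `|p' - x| < d -> `|q' - x| < d ->
  p - q = a *: (p' - q') ->
  `|F p - F q - a *: (F p' - F q')| <= e * `|p - q|.

Lemma near_scale (v : E) d : 0 < d -> \forall s \near (0 : R)^'+, `|s *: v| < d.
Proof.
move=> d0; have v1 : 0 < `|v| + 1 by rewrite ltr_wpDl.
near=> s; have s0 : 0 < s by near: s; exact: nbhs_right_gt.
rewrite normrZ gtr0_norm //.
apply: (@le_lt_trans _ _ (s * (`|v| + 1))); first by rewrite ler_pM2l // lerDl.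
rewrite -ltr_pdivlMr //; near: s; apply: nbhs_right_lt; exact: divr_gt0.
Unshelve. all: by end_near. Qed.

(** Take [s *: v + x1] and [x1] as second pair, with ratio [s^-1], and let [s] tend to 0. The point
    [x1] may differ from [x], which is what allows derivatives at neighbouring points to be
    compared. *)
Lemma collinear_approx_diff F x e d x1 p q : collinear_approx F x e d ->
  differentiable F x1 -> `|x1 - x| < d -> `|p - x| < d -> `|q - x| < d ->
  `|F p - F q - 'd F x1 (p - q)| <= e * `|p - q|.
Proof.
move=> cF dF x1d pd qd; set v := p - q.
apply/ler_addgt0Pr => e1 e10.
have v1 : 0 < `|v| + 1 by rewrite ltr_wpDl.
have [|r r0 Hr] := diff_normP dF (e := e1 / (`|v| + 1)); first exact: divr_gt0.
near (0 : R)^'+ => s.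
have s0 : 0 < s by near: s; exact: nbhs_right_gt.
have sr : `|s *: v| < r by near: s; exact: near_scale.
have sd : `|s *: v| < d - `|x1 - x| by near: s; apply: near_scale; rewrite subr_gt0.
have := Hr (s *: v + x1); rewrite addrK => /(_ sr).
rewrite linearZ normrZ gtr0_norm // => H1.
have := cF p q (s *: v + x1) x1 s^-1 pd qd _ x1d.
rewrite addrK scalerA mulVf ?gt_eqF // scale1r => H2.
have {}H2 : `|F p - F q - s^-1 *: (F (s *: v + x1) - F x1)| <= e * `|v|.
  apply: H2 => //; rewrite -addrA; apply: le_lt_trans (ler_normD _ _) _; lra.
have {}H1 : `|s^-1 *: (F (s *: v + x1) - F x1) - 'd F x1 v| <= e1.
  have -> : s^-1 *: (F (s *: v + x1) - F x1) - 'd F x1 v =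
      s^-1 *: (F (s *: v + x1) - F x1 - s *: 'd F x1 v).
    by rewrite [RHS]scalerBr scalerA mulVf ?gt_eqF // scale1r.
  rewrite normrZ gtr0_norm ?invr_gt0 // mulrC ler_pdivrMr //.
  apply: le_trans H1 _; rewrite mulrCA mulrC ler_pM2r // mulrAC.
  by rewrite ler_pdivrMr // ler_pM2l // lerDl.
have := ler_distD (s^-1 *: (F (s *: v + x1) - F x1)) (F p - F q) ('d F x1 v).
lra.
Unshelve. all: by end_near. Qed.

(** One small increment [s *: v] of [F], taken from [x1], is approximated both by ['d F x1] and by
    ['d F x]; dividing by [s] compares the two differentials at [v]. *)
Lemma collinear_approx_continuous F x (X : set E) v : open X -> X x ->
  (forall e, 0 < e -> exists2 d, 0 < d & collinear_approx F x e d) ->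
  (forall x', X x' -> differentiable F x') ->
  {for x, continuous (fun x' => 'd F x' v)}.
Proof.
move=> oX Xx cF dF; apply/continuous_normP => e e0.
have v1 : 0 < `|v| + 1 by rewrite ltr_wpDl.
have [|d d0 Hd] := cF (e / (2 * (`|v| + 1))); first by rewrite divr_gt0 // mulr_gt0.
have nX : nbhs x X by exact: open_nbhs_nbhs.
have [r r0 Hr] := (near_normP x X).1 nX.
exists (Num.min d r); first by rewrite lt_min d0 r0.
move=> x1; rewrite lt_min => /andP[x1d x1r].
have Xx1 := Hr _ x1r.
near (0 : R)^'+ => s.
have s0 : 0 < s by near: s; exact: nbhs_right_gt.
have sd : `|s *: v| < d - `|x1 - x| by near: s; apply: near_scale; rewrite subr_gt0.
have pd : `|s *: v + x1 - x| < d.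
  by rewrite -addrA; apply: le_lt_trans (ler_normD _ _) _; lra.
have xd : `|x - x| < d by rewrite subrr normr0.
have H1 := collinear_approx_diff Hd (dF _ Xx1) x1d pd x1d.
have H2 := collinear_approx_diff Hd (dF _ Xx) xd pd x1d.
have : `|'d F x1 (s *: v) - 'd F x (s *: v)| <= 2 * (e / (2 * (`|v| + 1)) * `|s *: v|).
  move: H1 H2; rewrite addrK; set A := F _ - _.
  have := ler_distD A ('d F x1 (s *: v)) ('d F x (s *: v)).
  by rewrite (distrC _ A); lra.
rewrite !linearZ /= -scalerDr !normrZ gtr0_norm // => H.
have {}H : `|'d F x1 v - 'd F x v| <= 2 * (e / (2 * (`|v| + 1)) * `|v|).
  by rewrite -(ler_pM2l s0); apply: le_trans H _; rewrite le_eqVlt; apply/orP; left; apply/eqP; ring.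
apply: le_lt_trans H _.
have -> : 2 * (e / (2 * (`|v| + 1)) * `|v|) = e * (`|v| / (`|v| + 1)).
  by field; rewrite gt_eqF.
by rewrite gtr_pMr // ltr_pdivrMr // mul1r ltrDl.
Unshelve. all: by end_near. Qed.

(** Stated for real functions: [V] is just a normed module, and the difference quotients are shown
    to converge coordinate by coordinate. *)
Lemma cauchy_dnbhs_cvg (g : R -> R) :
  (forall e, 0 < e -> exists2 d, 0 < d & forall s s', s != 0 -> s' != 0 ->
     `|s| < d -> `|s'| < d -> `|g s - g s'| <= e) ->
  cvg (g @ (0 : R)^').
Proof.
move=> H; apply: cauchy_cvg; apply: cauchy_exP => e e0.
have e20 : 0 < e / 2 by rewrite divr_gt0.
have [d d0 Hd] := H _ e20.
have d2 : 0 < d / 2 by rewrite divr_gt0.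
exists (g (d / 2)); rewrite -ball_normE.
change (\forall s \near within (fun s : R => s != 0) (nbhs (0 : R)),
  `|g (d / 2) - g s| < e).
rewrite near_withinE; apply: (@near_normP R R 0 _).2; exists d => // s; rewrite subr0 => sd s0 /=.
have := Hd (d / 2) s (lt0r_neq0 d2) s0.
rewrite gtr0_norm // => H1.
apply: le_lt_trans (H1 _ sd) _; lra.
Qed.

(* The difference quotients along each direction are Cauchy by the collinear
   case [q = q' = x]; their limit is additive because [x + s v1 + s v2] can be
   reached from [x] through [x + s v2]. *)
Lemma collinear_approx_differentiable (C : sup_coords V) F x (M r : R) :
  (forall e, 0 < e -> exists2 d, 0 < d & collinear_approx F x e d) ->
  0 < r -> (forall p, `|p - x| < r -> `|F p - F x| <= M * `|p - x|) ->
  differentiable F x.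
Proof.
move=> cF r0 HM.
have v1 (v : E) : 0 < `|v| + 1 by rewrite ltr_wpDl.
pose Q v (s : R) := s^-1 *: (F (s *: v + x) - F x).
have Qcol e d v s s' : collinear_approx F x e d -> s != 0 -> s' != 0 ->
    `|s *: v| < d -> `|s' *: v| < d -> `|Q v s - Q v s'| <= e * `|v|.
  move=> Hd s0 s'0 sd s'd.
  have d0 : 0 < d by apply: le_lt_trans sd.
  have := Hd (s *: v + x) x (s' *: v + x) x (s / s').
  rewrite !addrK subrr normr0 scalerA divfK // => /(_ sd d0 s'd d0 erefl).
  have -> : F (s *: v + x) - F x - (s / s') *: (F (s' *: v + x) - F x) =
      s *: (Q v s - Q v s').
    by rewrite [RHS]scalerBr /Q !scalerA divff // scale1r.
  by rewrite !normrZ mulrCA ler_pM2l // normr_gt0.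
have Qcvg v : exists u : V, Q v @ (0 : R)^' --> u.
  have ci i : cvg (sc_crd C i \o Q v @ (0 : R)^').
    apply: cauchy_dnbhs_cvg => e e0.
    have [|d d0 Hd] := cF (e / (`|v| + 1)); first exact: divr_gt0.
    have small s : `|s| < d / (`|v| + 1) -> `|s *: v| < d.
      rewrite ltr_pdivlMr // normrZ => sd; apply: le_lt_trans sd.
      by rewrite ler_wpM2l // lerDl.
    exists (d / (`|v| + 1)); first exact: divr_gt0.
    move=> s s' s0 s'0 /small sd /small s'd /=.
    rewrite -linearB; apply: le_trans (sc_le _ _ _) _.
    apply: le_trans (Qcol _ _ _ _ _ Hd s0 s'0 sd s'd) _.
    by rewrite mulrAC ler_pdivrMr // ler_pM2l // lerDl.
  pose L i := lim (sc_crd C i \o Q v @ (0 : R)^').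
  exists (\sum_i L i *: sc_vec C i).
  rewrite (_ : Q v = fun s => \sum_i sc_crd C i (Q v s) *: sc_vec C i); last first.
    by apply/funext => s; exact: sc_sum.
  elim: (index_enum (sc_idx C)) => [|i l IH].
    rewrite (_ : (fun _ => _) = cst 0); first by rewrite big_nil; exact: cvg_cst.
    by apply/funext => s; rewrite big_nil.
  rewrite big_cons (_ : (fun _ => _) = (fun s => sc_crd C i (Q v s) *: sc_vec C i +
     \sum_(j <- l) sc_crd C j (Q v s) *: sc_vec C j)).
    apply: cvgD => //.
    exact: cvgZr_tmp (ci i).
  by apply/funext => s; rewrite big_cons.
have /choice[u Hu] := Qcvg.
have uN v e : 0 < e -> \forall s \near (0 : R)^'+, `|Q v s - u v| < e.
  move=> e0; have /cvgrPdistC_lt/(_ e e0) := Hu v.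
  rewrite !near_withinE; apply: filterS => s Hs s0; apply: Hs.
  exact: lt0r_neq0.
have ulin : linear u.
  move=> a v w; apply/eqP; rewrite -subr_eq0 -normr_le0.
  apply/ler_addgt0Pr => e e0; rewrite add0r.
  have av1 : 0 < `|a *: v| + 1 by [].
  (* Four errors add up to [e]: three from replacing [u] by its quotients, one from
     [collinear_approx]. The quotient along [v] is multiplied by [a], hence the further division by
     [|a| + 1]. *)
  have e4 : 0 < e / 4 by rewrite divr_gt0.
  have ea : 0 < e / 4 / (`|a| + 1) by rewrite divr_gt0 // ltr_wpDl.
  have [|d d0 Hd] := cF (e / 4 / (`|a *: v| + 1)); first exact: divr_gt0.
  near (0 : R)^'+ => s.
  have s0 : 0 < s by near: s; exact: nbhs_right_gt.
  have H1 : `|Q (a *: v + w) s - u (a *: v + w)| < e / 4 by near: s; exact: uN.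
  have H2 : `|Q v s - u v| < e / 4 / (`|a| + 1) by near: s; exact: uN.
  have H3 : `|Q w s - u w| < e / 4 by near: s; exact: uN.
  have sd1 : `|s *: (a *: v + w)| < d by near: s; exact: near_scale.
  have sd2 : `|s *: v| < d by near: s; exact: near_scale.
  have sd3 : `|s *: w| < d by near: s; exact: near_scale.
  have := Hd (s *: (a *: v + w) + x) (s *: w + x) (s *: v + x) x a.
  rewrite !addrK subrr normr0 => /(_ sd1 sd3 sd2 d0) Hcol.
  have Ediff : s *: (a *: v + w) + x - (s *: w + x) = a *: (s *: v).
    by rewrite opprD addrACA subrr addr0 scalerDr addrK !scalerA mulrC.
  have {Hcol} H4 : `|Q (a *: v + w) s - Q w s - a *: Q v s| <= e / 4.
    have -> : Q (a *: v + w) s - Q w s - a *: Q v s = s^-1 *: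
        (F (s *: (a *: v + w) + x) - F (s *: w + x) - a *: (F (s *: v + x) - F x)).
      rewrite /Q [RHS]scalerBr scalerA [a * _]mulrC -scalerA; congr (_ - _).
      by rewrite -scalerBr opprB addrA subrK.
    rewrite normrZ gtr0_norm ?invr_gt0 // mulrC ler_pdivrMr //.
    have N : `|a *: (s *: v)| = s * `|a *: v|.
      by rewrite scalerA mulrC -scalerA normrZ gtr0_norm.
    apply: le_trans (Hcol Ediff) _; rewrite Ediff N mulrCA [leLHS]mulrC ler_pM2r //.
    by rewrite mulrAC ler_pdivrMr // ler_pM2l // lerDl.
  have {}H2 : `|a *: Q v s - a *: u v| <= e / 4.
    rewrite -scalerBr normrZ; apply: (@le_trans _ _ ((`|a| + 1) * `|Q v s - u v|)).
      by rewrite ler_wpM2r // lerDl.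
    by rewrite mulrC -ler_pdivlMr ?ltr_wpDl // ltW.
  have -> : u (a *: v + w) - (a *: u v + u w) =
     (Q (a *: v + w) s - Q w s - a *: Q v s) - (Q (a *: v + w) s - u (a *: v + w))
     + (Q w s - u w) + (a *: Q v s - a *: u v).
    have canc (y z t : V) : y - z + (z - t) = y - t by rewrite addrA subrK.
    set q1 := Q _ s; set q2 := Q w s; set q3 := a *: Q v s; set u1 := u _.
    have -> : q1 - q2 - q3 - (q1 - u1) = u1 - q3 - q2.
      by rewrite opprB addrC !addrA subrK addrAC.
    by rewrite canc addrAC canc opprD addrA addrAC.
  apply: le_trans (ler_normD _ _) _.
  apply: le_trans (lerD (ler_normD _ _) (lexx _)) _.
  apply: le_trans (lerD (lerD (ler_normB _ _) (lexx _)) (lexx _)) _; lra.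
have [u' u'E] := linear_pack ulin.
have near_u v e : 0 < e -> exists s, 0 < s /\ `|Q v s - u v| < e /\ `|s *: v| < r.
  move=> e0; near (0 : R)^'+ => s; exists s; split.
    by near: s; exact: nbhs_right_gt.
  by split; near: s; [exact: uN|exact: near_scale].
(* [E] is an arbitrary normed module, so linearity does not give continuity; the bound [HM] on
   increments passes to the limit of the quotients. *)
have cu : continuous u'.
  apply/linear_continuous_bound; exists (`|M| + 1); first by rewrite ltr_wpDl.
  move=> v; rewrite u'E.
  apply: (@le_trans _ _ (`|M| * `|v|)); last by rewrite ler_wpM2r // lerDl.
  apply/ler_addgt0Pr => e e0.
  have [s [s0 [Hs sr]]] := near_u v e e0.
  have : `|Q v s| <= `|M| * `|v|.
    rewrite normrZ gtr0_norm ?invr_gt0 // mulrC ler_pdivrMr //.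
    have := HM (s *: v + x); rewrite addrK => /(_ sr) H.
    apply: le_trans H _; rewrite normrZ gtr0_norm // mulrCA [leRHS]mulrC.
    by rewrite ler_pM2l //; apply: ler_wpM2r => //; exact: ler_norm.
  by have := ler_normB (Q v s) (Q v s - u v); rewrite subKr; lra.
have [] // := diff_normI cu (F := F) (x := x).
move=> e e0; have [d d0 Hd] := cF e e0; exists d => // p pd.
rewrite u'E; apply/ler_addgt0Pr => e1 e10.
near (0 : R)^'+ => s.
have s0 : 0 < s by near: s; exact: nbhs_right_gt.
have H1 : `|Q (p - x) s - u (p - x)| < e1 by near: s; exact: uN.
have sd : `|s *: (p - x)| < d by near: s; exact: near_scale.
(* The quotient along [p - x] at parameter 1 is the increment [F p - F x] itself, so comparing the
   parameters 1 and [s] bounds the remainder uniformly in the direction. *)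
have := Qcol e d (p - x) 1 s Hd (oner_neq0 _) (lt0r_neq0 s0).
rewrite scale1r /Q invr1 !scale1r subrK -/(Q (p - x) s) => /(_ pd sd) H2.
by have := ler_distD (Q (p - x) s) (F p - F x) (u (p - x)); lra.
Unshelve. all: by end_near. Qed.

End StrictDerivative.

(** * Closure properties of the classes [Ck] and [C0k] *)

Section ClassClosure.
Context (R : realType).
Implicit Types (V W : normedModType R).

Lemma near_eq_differentiable V W (F G : V -> W) y :
  (\near y, F y = G y) -> differentiable F y ->
  differentiable G y /\ 'd G y = 'd F y :> (V -> W).
Proof.
move=> /near_normP[d d0 Hd] dF; apply: diff_normI; first exact: diff_continuous.
move=> e e0; have [r r0 Hr] := diff_normP dF e0.
exists (Num.min d r); first by rewrite lt_min d0 r0.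
move=> p; rewrite lt_min => /andP[pd pr].
rewrite -(Hd p pd) -(Hd y _); first exact: Hr.
by rewrite subrr normr0.
Qed.

Lemma near_eq_continuous V W (F G : V -> W) y :
  (\near y, F y = G y) -> {for y, continuous F} -> {for y, continuous G}.
Proof.
move=> FG cF; have FGy := nbhs_singleton FG.
by move: cF; rewrite /prop_for /continuous_at FGy; apply: cvg_trans; exact: near_eq_cvg.
Qed.

Lemma open_slice V (Om : set (R * V)) t : open Om -> open [set y | Om (t, y)].
Proof.
move=> oOm; rewrite openE => y Oy; rewrite /interior.
have [d d0 Hd] := (@near_normP R (R * V)%type (t, y) Om).1 (open_nbhs_nbhs (conj oOm Oy)).
apply/near_normP; exists d => // p py; apply: Hd.
by rewrite prod_normE /= subrr normr0 gt_max d0.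
Qed.

(** Differentiation rules hold only at points of [U]; as [U] is open, the closure proofs can replace
    ['d F _ v] by its formula there and apply the induction hypothesis. [C0k_eq] plays the same
    role. *)
Lemma Ck_eq V W (U : set V) k (F G : V -> W) : open U ->
  (forall y, U y -> F y = G y) -> Ck U k F -> Ck U k G.
Proof.
move=> oU; elim: k F G => [|k IHk] F G FG /=.
  move=> cF x Ux; apply: near_eq_continuous (cF x Ux).
  exact: filterS FG (open_nbhs_nbhs (conj oU Ux)).
have near_FG x : U x -> \near x, F x = G x.
  by move=> Ux; exact: filterS FG (open_nbhs_nbhs (conj oU Ux)).
move=> [dF cdF]; split=> [x Ux|v].
  by have [] := near_eq_differentiable (near_FG x Ux) (dF x Ux).
apply: IHk (cdF v) => y Uy.
by have [_ ->] := near_eq_differentiable (near_FG y Uy) (dF y Uy).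
Qed.

Lemma Ck_linear V W W' (U : set V) k (F : V -> W) (M : {linear W -> W'}) :
  open U -> continuous M -> Ck U k F -> Ck U k (M \o F).
Proof.
move=> oU cM; elim: k F => [|k IHk] F /=.
  by move=> cF x Ux; apply: continuous_comp; [exact: cF|exact: cM].
move=> [dF cdF]; split=> [x Ux|v].
  by apply: differentiable_comp; [exact: dF|exact: linear_differentiable].
apply: Ck_eq (IHk _ (cdF v)) => // y Uy.
rewrite diff_comp ?diff_lin //; [exact: dF|exact: linear_differentiable].
Qed.

Lemma C0k_continuous V W (Om : set (R * V)) k (F : R * V -> W) z :
  C0k Om k F -> Om z -> {for z, continuous F}.
Proof. by case: k => [|k] [cF _]; exact: cF. Qed.

Lemma C0k_pred V W (Om : set (R * V)) k (F : R * V -> W) :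
  C0k Om k.+1 F -> C0k Om k F.
Proof.
elim: k F => [|k IHk] F [cF [dF cdF]]; split=> //.
by split=> // v; apply: IHk; exact: cdF.
Qed.

Lemma C0k_eq V W (Om : set (R * V)) k (F G : R * V -> W) : open Om ->
  (forall z, Om z -> F z = G z) -> C0k Om k F -> C0k Om k G.
Proof.
move=> oOm; elim: k F G => [|k IHk] F G FG [cF HF].
  split=> // z Oz; apply: near_eq_continuous (cF z Oz).
  exact: filterS FG (open_nbhs_nbhs (conj oOm Oz)).
have [dF cdF] := HF; split=> [z Oz|].
  apply: near_eq_continuous (cF z Oz).
  exact: filterS FG (open_nbhs_nbhs (conj oOm Oz)).
have near_FG t y : Om (t, y) -> \near y, F (t, y) = G (t, y).
  move=> Oy; have := open_nbhs_nbhs (conj (open_slice t oOm) Oy).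
  by apply: filterS => p; exact: FG.
split=> [t y Oy|v].
  by have [] := near_eq_differentiable (near_FG t y Oy) (dF t y Oy).
apply: IHk (cdF v) => -[t y] Oy.
by have [_ ->] := near_eq_differentiable (near_FG t y Oy) (dF t y Oy).
Qed.

Lemma C0k_linear V W W' (Om : set (R * V)) k (F : R * V -> W)
    (M : {linear W -> W'}) :
  open Om -> continuous M -> C0k Om k F -> C0k Om k (M \o F).
Proof.
move=> oOm cM; elim: k F => [|k IHk] F [cF HF].
  by split=> // z Oz; apply: continuous_comp; [exact: cF|exact: cM].
have [dF cdF] := HF; split=> [z Oz|].
  by apply: continuous_comp; [exact: cF|exact: cM].
split=> [t y Oy|v].
  apply: (@differentiable_comp _ _ _ _ (fun h => F (t, h)) M); first exact: dF.
  exact: linear_differentiable.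
apply: C0k_eq (IHk _ (cdF v)) => // -[t y] Oy.
rewrite (@diff_comp _ _ _ _ (fun h => F (t, h)) M) ?diff_lin //; first exact: dF.
exact: linear_differentiable.
Qed.

(** Meant for [P = fst], to regard [f] and its directional derivatives as maps on the doubled state
    space. *)
Lemma C0k_precomp_linear V V' W (Om : set (R * V)) k (F : R * V -> W)
    (P : {linear V' -> V}) :
  open [set z : R * V' | Om (z.1, P z.2)] -> continuous P -> C0k Om k F ->
  C0k [set z : R * V' | Om (z.1, P z.2)] k (fun z => F (z.1, P z.2)).
Proof.
move=> oOm cP.
have cG (F' : R * V -> W) : (forall z, Om z -> {for z, continuous F'}) ->
    forall z, Om (z.1, P z.2) -> {for z, continuous (fun z : R * V' => F' (z.1, P z.2))}.
  move=> cF' z Oz; apply: (@continuous_comp _ _ _ (fun z : R * V' => (z.1, P z.2)) F').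
    have c1 : {for z, continuous (fun z : R * V' => z.1)} by exact: cvg_fst.
    have c2 : {for z, continuous (fun z : R * V' => P z.2)}.
      by apply: (@continuous_comp _ _ _ snd P); [exact: cvg_snd|exact: cP].
    exact: (cvg_pair c1 c2).
  exact: cF'.
elim: k F => [|k IHk] F [cF HF]; first by split=> // z; exact: cG.
have [dF cdF] := HF; split=> [z|]; first exact: cG.
split=> [t y Oy|v].
  apply: (@differentiable_comp _ _ _ _ P (fun h => F (t, h))).
    exact: linear_differentiable.
  exact: dF.
apply: C0k_eq (IHk _ (cdF (P v))) => // -[t y] Oy.
rewrite (@diff_comp _ _ _ _ P (fun h => F (t, h))) ?diff_lin //.
  exact: linear_differentiable.
exact: dF.
Qed.

Lemma C0kD V W (Om : set (R * V)) k (F G : R * V -> W) : open Om ->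
  C0k Om k F -> C0k Om k G -> C0k Om k (fun z => F z + G z).
Proof.
move=> oOm; elim: k F G => [|k IHk] F G [cF HF] [cG HG].
  by split=> // z Oz; apply: continuousD; [exact: cF|exact: cG].
have [dF cdF] := HF; have [dG cdG] := HG; split=> [z Oz|].
  by apply: continuousD; [exact: cF|exact: cG].
split=> [t y Oy|v].
  by apply: differentiableD; [exact: dF|exact: dG].
apply: C0k_eq (IHk _ _ (cdF v) (cdG v)) => // -[t y] Oy.
by rewrite (@diffD _ _ _ (fun h => F (t, h)) (fun h => G (t, h))) //; [exact: dF|exact: dG].
Qed.

(** The variational equation is linear in the variation, so the products to differentiate have a
    coordinate form as scalar factor. *)
Lemma diff_scale_linear V W (l : {linear V -> R}) (g : V -> W) y :
  continuous l -> differentiable g y ->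
  differentiable (fun h => l h *: g h) y /\
  'd (fun h => l h *: g h) y = (fun v => l v *: g y + l y *: 'd g y v) :> (V -> W).
Proof.
move=> cl dg.
have [u uE] : exists u : {linear V -> W},
    u = (fun v => l v *: g y + l y *: 'd g y v) :> (V -> W).
  apply: linear_pack => a v w /=.
  rewrite [l _]linearP ['d g y _]linearP /= scalerDl !scalerDr addrACA.
  by rewrite !scalerA [l y * a]mulrC.
have [K K0 HK] := (linear_continuous_bound l).1 cl.
have [K' K'0 HK'] := (linear_continuous_bound ('d g y)).1 (diff_continuous dg).
have cu : continuous u.
  apply/linear_continuous_bound; exists (K * `|g y| + `|l y| * K' + 1).
    by rewrite ltr_wpDl // addr_ge0 // mulr_ge0 // ltW.
  move=> v; rewrite uE; apply: le_trans (ler_normD _ _) _; rewrite !normrZ.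
  have := ler_wpM2r (normr_ge0 (g y)) (HK v).
  have := ler_wpM2l (normr_ge0 (l y)) (HK' v).
  have := normr_ge0 v; lra.
rewrite -uE; apply: diff_normI => // e e0.
have ly1 : 0 < `|l y| + 1 by rewrite ltr_wpDl.
have /continuous_normP/(_ (e / (2 * K)))[|d1 d10 H1] := differentiable_continuous dg.
  by rewrite divr_gt0 // mulr_gt0.
have [|d2 d20 H2] := diff_normP dg (e := e / (2 * (`|l y| + 1))).
  by rewrite divr_gt0 // mulr_gt0.
exists (Num.min d1 d2); first by rewrite lt_min d10 d20.
move=> p; rewrite lt_min => /andP[pd1 pd2]; rewrite uE.
have -> : l p *: g p - l y *: g y - (l (p - y) *: g y + l y *: 'd g y (p - y)) =
    l (p - y) *: (g p - g y) + l y *: (g p - g y - 'd g y (p - y)).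
  have -> : l (p - y) = l p - l y by rewrite linearB.
  move: (l p) (l y) (g p) (g y) ('d g y (p - y)) => a b G G' D.
  rewrite opprD addrA -[a *: G - _ - _]addrA -opprD -scalerDl [b + _]addrC subrK.
  by rewrite [b *: (_ - D)]scalerBr [RHS]addrA -scalerDl subrK scalerBr.
apply: le_trans (ler_normD _ _) _; rewrite !normrZ.
have G1 : `|l (p - y)| * `|g p - g y| <= e / 2 * `|p - y|.
  apply: (@le_trans _ _ (K * `|p - y| * (e / (2 * K)))).
    by apply: ler_pM => //; exact/ltW/H1.
  by rewrite le_eqVlt; apply/orP; left; apply/eqP; field; rewrite gt_eqF.
have G2 : `|l y| * `|g p - g y - 'd g y (p - y)| <= e / 2 * `|p - y|.
  apply: (@le_trans _ _ ((`|l y| + 1) * (e / (2 * (`|l y| + 1)) * `|p - y|))).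
    by apply: ler_pM => //; [rewrite lerDl|exact: H2].
  by rewrite le_eqVlt; apply/orP; left; apply/eqP; field; rewrite gt_eqF.
lra.
Qed.

Lemma C0k_scale V W (Om : set (R * V)) k (l : {linear V -> R}) (G : R * V -> W) :
  open Om -> continuous l ->
  C0k Om k G -> C0k Om k (fun z => l z.2 *: G z).
Proof.
move=> oOm cl.
have cs (G' : R * V -> W) z : {for z, continuous G'} ->
    {for z, continuous (fun z : R * V => l z.2 *: G' z)}.
  move=> cG'; apply: continuousZ => //.
  by apply: (@continuous_comp _ _ _ snd l); [exact: cvg_snd|exact: cl].
elim: k G => [|k IHk] G HkG; have [cG HG] := HkG.
  by split=> // z Oz; apply: cs; exact: cG.
have [dG cdG] := HG; split=> [z Oz|]; first by apply: cs; exact: cG.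
split=> [t y Oy|v].
  by have [] := diff_scale_linear cl (dG t y Oy).
have [sv svE] : exists sv : {linear W -> W}, sv = ( *:%R (l v)) :> (W -> W).
  by apply: linear_pack => a x w; rewrite scalerDr !scalerA mulrC.
have csv : continuous sv by rewrite svE; exact: scaler_continuous.
have H1 : C0k Om k (sv \o G) by apply: C0k_linear => //; exact: C0k_pred.
apply: C0k_eq (C0kD oOm H1 (IHk _ (cdG v))) => // -[t y] Oy /=.
by have [_ ->] := diff_scale_linear cl (dG t y Oy); rewrite svE.
Qed.

Lemma C0k0 V W (Om : set (R * V)) k : open Om -> C0k Om k (fun=> 0 : W).
Proof.
move=> oOm; elim: k => [|k IHk]; split=> //.
- by move=> z _; exact: cst_continuous.
- by move=> z _; exact: cst_continuous.
split=> [t y _|v]; first exact: differentiable_cst.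
by apply: C0k_eq IHk => // -[t y] _; rewrite diff_cst.
Qed.

Lemma C0k_sum V W (I : finType) (Om : set (R * V)) k (F : I -> R * V -> W) :
  open Om -> (forall i, C0k Om k (F i)) -> C0k Om k (fun z => \sum_i F i z).
Proof.
move=> oOm CF; elim: (index_enum I) => [|i r IHr].
  apply: C0k_eq (@C0k0 V W Om k oOm) => // z _; rewrite big_nil //.
by apply: C0k_eq (C0kD oOm (CF i) IHr) => // z _; rewrite big_cons.
Qed.

End ClassClosure.

(** * Sup coordinates on products *)

Section ProductCoordinates.
Context (R : realType) (V W : normedModType R).
Variables (C : sup_coords V) (C' : sup_coords W).

Let crd (i : sc_idx C + sc_idx C') : {linear (V * W)%type -> R} :=
  match i with
  | inl i => sc_crd C i \o fst
  | inr j => sc_crd C' j \o snd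
  end.

Let vec (i : sc_idx C + sc_idx C') : V * W :=
  match i with
  | inl i => (sc_vec C i, 0)
  | inr j => (0, sc_vec C' j)
  end.

(** The product norm is a maximum, so the disjoint union of the two families of forms reproduces it
    exactly. *)
Lemma sup_coords_prod : sup_coords (V * W)%type.
Proof.
have fst_sum (I : finType) (F : I -> V * W) : (\sum_i F i).1 = \sum_i (F i).1.
  by apply: (big_morph fst) => // -[].
have snd_sum (I : finType) (F : I -> V * W) : (\sum_i F i).2 = \sum_i (F i).2.
  by apply: (big_morph snd) => // -[].
apply: (@SupCoords _ _ _ crd vec) => [v|[i|i] v|v M M0 H].
- rewrite big_sumType /= [LHS]surjective_pairing; congr (_, _).
    change (v.1 = (\sum_i (sc_crd C i v.1 *: (sc_vec C i, 0)) : V * W).1 +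
                  (\sum_i (sc_crd C' i v.2 *: (0, sc_vec C' i)) : V * W).1).
    rewrite !fst_sum /= [X in _ + X]big1 ?addr0; first exact: sc_sum.
    by move=> i _; rewrite scaler0.
  change (v.2 = (\sum_i (sc_crd C i v.1 *: (sc_vec C i, 0)) : V * W).2 +
                (\sum_i (sc_crd C' i v.2 *: (0, sc_vec C' i)) : V * W).2).
  rewrite !snd_sum /= [X in X + _]big1 ?add0r; first exact: sc_sum.
  by move=> i _; rewrite scaler0.
- by rewrite prod_normE le_max (sc_le C i v.1).
- by rewrite prod_normE le_max (sc_le C' i v.2) orbT.
- rewrite prod_normE ge_max; apply/andP; split.
    by apply: (sc_sup C) => // i; exact: (H (inl i)).
  by apply: (sc_sup C') => // i; exact: (H (inr i)).
Qed.

End ProductCoordinates.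

(** * The variational system *)

Section Augmented.
Context (R : realType) (V : normedModType R).

(** The tangent lift of the field [f]: its second component is the right-hand side of the
    variational equation. *)
Definition augmented (f : R * V -> V) (z : R * (V * V)) : V * V :=
  (f (z.1, z.2.1), 'd (fun h : V => f (z.1, h)) (z.2.1) z.2.2).

Lemma open_fst_slice (Om : set (R * V)) :
  open Om -> open [set z : R * (V * V) | Om (z.1, z.2.1)].
Proof.
move=> oOm; rewrite openE => z Oz; rewrite /interior.
have [d d0 Hd] := (@near_normP R (R * V)%type _ Om).1 (open_nbhs_nbhs (conj oOm Oz)).
apply: (@near_normP R (R * (V * V))%type z _).2.
exists d => // p; rewrite !prod_normE /= !gt_max => /andP[p1 /andP[p2 _]].
by apply: Hd; rewrite prod_normE /= gt_max p1.
Qed.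

(** In the second component the direction is itself a variable, whereas [C0k] speaks of fixed
    directions. Expanding [z.2.2] in coordinates gives a finite sum of coordinate forms times
    derivatives in the directions [sc_vec C i], at the price of one order. *)
Lemma C0k_augmented (C : sup_coords V) (Om : set (R * V)) k (f : R * V -> V) :
  open Om -> C0k Om k.+1 f ->
  C0k [set z : R * (V * V) | Om (z.1, z.2.1)] k (augmented f).
Proof.
move=> oOm Cf; have oOm' := open_fst_slice oOm.
have cfst : continuous (fst : V * V -> V) by move=> z; exact: cvg_fst.
have csnd : continuous (snd : V * V -> V) by move=> z; exact: cvg_snd.
have [cf [df cdf]] := Cf.
have [i1 i1E] : exists i1 : {linear V -> (V * V)%type}, i1 = (fun v => (v, 0)) :> (V -> V * V).
  apply: (@linear_pack R V (V * V)%type) => a v w.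
  by congr (_, _); rewrite /= ?scaler0 ?addr0.
have [i2 i2E] : exists i2 : {linear V -> (V * V)%type}, i2 = (fun v => (0, v)) :> (V -> V * V).
  apply: (@linear_pack R V (V * V)%type) => a v w.
  by congr (_, _); rewrite /= ?scaler0 ?addr0.
have ci1 : continuous i1.
  apply/linear_continuous_bound; exists 1 => // v.
  by rewrite i1E mul1r prod_normE /= normr0 ge_max lexx normr_ge0.
have ci2 : continuous i2.
  apply/linear_continuous_bound; exists 1 => // v.
  by rewrite i2E mul1r prod_normE /= normr0 ge_max lexx normr_ge0.
have H1 := @C0k_precomp_linear R V (V * V)%type V Om k f fst oOm' cfst (C0k_pred Cf).
have H2 i : C0k [set z : R * (V * V) | Om (z.1, z.2.1)] k (fun z =>
    (sc_crd C i \o snd) z.2 *: 'd (fun h : V => f (z.1, h)) (z.2.1) (sc_vec C i)).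
  apply: (@C0k_scale R (V * V)%type V) => //.
    by move=> z; apply: continuous_comp; [exact: csnd|exact: sc_continuous].
  exact: (@C0k_precomp_linear R V (V * V)%type V Om k _ fst oOm' cfst (cdf (sc_vec C i))).
have := C0kD oOm' (C0k_linear oOm' ci1 H1) (C0k_linear oOm' ci2 (C0k_sum oOm' H2)).
apply: C0k_eq => // z Oz; rewrite /= i1E i2E /augmented.
congr (_, _); rewrite ?addr0 ?add0r //.
by rewrite [in RHS](sc_sum C z.2.2) linear_sum; apply: eq_bigr => i _; rewrite linearZ.
Qed.

End Augmented.

(** * Uniform limits of curves and of their derivatives *)

Section UniformLimit.
Context (R : realType) (V : normedModType R) (C : sup_coords V) (T : R).
Implicit Types (u g q dq : R -> V).

Lemma uniform_approx_continuous u :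
  (forall e : R, 0 < e -> exists2 q, {within `[0, T], continuous q} &
    forall t : R, t \in `[0, T] -> `|q t - u t| <= e) ->
  {within `[0, T], continuous u}.
Proof.
move=> H; apply/within_normP => t t_in e e0.
have e4 : 0 < e / 4 by rewrite divr_gt0.
have [q cq qu] := H _ e4.
have /within_normP/(_ t t_in _ e4)[d d0 Hd] := cq.
exists d => // s s_in sd; have := Hd s s_in sd.
have := qu s s_in; have := qu t t_in.
have := ler_distD (q s) (u s) (u t); have := ler_distD (q t) (q s) (u t).
by rewrite (distrC (u s) (q s)); lra.
Qed.

(** The radius is taken from the continuity of [g] at [t], before any approximation. The mean value
    inequality for [q r - r *: g t] then gives [e * |s - t|] whatever the chosen [q], and what
    remains is an error [e1] in the values, arbitrarily small once [s] is fixed. *)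
Lemma uniform_approx_derive u g :
  (forall e : R, 0 < e -> exists q dq, [/\
    forall t : R, t \in `]0, T[ -> is_derive t (1 : R) q (dq t),
    forall t : R, t \in `[0, T] -> `|q t - u t| <= e &
    forall t : R, t \in `]0, T[ -> `|dq t - g t| <= e]) ->
  {within `[0, T], continuous g} ->
  forall t : R, t \in `]0, T[ -> is_derive t (1 : R) u (g t).
Proof.
move=> H cg t t_in; apply/is_derive_normP => e e0.
have e2 : 0 < e / 2 by rewrite divr_gt0.
have /andP[t0 tT] : 0 < t < T by rewrite in_itv in t_in.
have t_cc : t \in `[0, T] by exact: subset_itv_oo_cc.
have /within_normP/(_ t t_cc _ e2)[d d0 Hd] := cg.
exists (Num.min d (Num.min t (T - t))); first by rewrite !lt_min d0 t0 subr_gt0.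
move=> s; rewrite !lt_min => /andP[sd /andP[st sT]].
apply/ler_addgt0Pr => e1 e10.
(* [e / 2] is the allowance for [dq - g], the other half being the oscillation of [g]; [e1 / 2] is
   the allowance for each of [q s] and [q t]. *)
pose e3 := Num.min (e / 2) (e1 / 2).
have e30 : 0 < e3 by rewrite lt_min e2 divr_gt0.
have [q [dq [Dq qu dqg]]] := H e3 e30.
have near_t (r : R) : `|r - t| <= `|s - t| ->
    [/\ r \in `]0, T[, r \in `[0, T] & `|g r - g t| < e / 2].
  move=> rs; have r_in : r \in `]0, T[.
    have := le_lt_trans rs st; have := le_lt_trans rs sT.
    rewrite in_itv /= !ltr_norml => /andP[? ?] /andP[? ?].
    by apply/andP; split; lra.
  have r_cc : r \in `[0, T] by exact: subset_itv_oo_cc.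
  by split=> //; apply: Hd => //; exact: le_lt_trans sd.
have inc (a b : R) : a <= b ->
    (forall r : R, r \in `[a, b] -> `|r - t| <= `|s - t|) ->
    `|q b - q a - (b - a) *: g t| <= e * (b - a).
  move=> ab Hab; pose w (r : R) := q r - r *: g t.
  have Dw (r : R) : r \in `[a, b] -> is_derive r (1 : R) w (dq r - g t).
    move=> /Hab/near_t[r_in _ _]; apply: is_deriveB; first exact: Dq.
    apply/is_derive_normP => e4 e40; exists 1 => // r' _.
    by rewrite -scalerBl subrr normr0 mulr_ge0 // ltW.
  have cw : {within `[a, b], continuous w}.
    apply/subspace_continuousP => r r_in; apply: cvg_within_filter.
    apply: differentiable_continuous; apply/derivable1_diffP.
    by case: (Dw r r_in).
  have -> : q b - q a - (b - a) *: g t = w b - w a.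
    by rewrite /w scalerBl [- (q a - _)]opprD addrACA -opprD.
  have Dw' (r : R) : r \in `]a, b[ -> is_derive r (1 : R) w (dq r - g t).
    by move=> /subset_itv_oo_cc; exact: Dw.
  have le_e (r : R) : r \in `]a, b[ -> `|dq r - g t| <= e.
    move=> /subset_itv_oo_cc r_in.
    have [r_oo _ Hg] := near_t r (Hab r r_in).
    have := ler_distD (g r) (dq r) (g t); have := dqg r r_oo.
    have : e3 <= e / 2 by rewrite ge_min lexx.
    lra.
  exact: (norm_le_increment_cst C (dw := fun r => dq r - g t) ab cw Dw' le_e).
have Hq : `|q s - q t - (s - t) *: g t| <= e * `|s - t|.
  have [st'|ts'] := leP t s.
    rewrite [X in e * X]ger0_norm ?subr_ge0 //; apply: inc => // r.
    rewrite in_itv /= => /andP[tr rs]; rewrite !ger0_norm ?subr_ge0 //; lra.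
  have -> : q s - q t - (s - t) *: g t = - (q t - q s - (t - s) *: g t).
    by rewrite opprB opprB addrC -[t - s]opprB scaleNr.
  rewrite normrN [`|s - t|]distrC [`|t - s|]gtr0_norm ?subr_gt0 //.
  apply: inc; first exact: ltW.
  move=> r; rewrite in_itv /= => /andP[sr rt].
  by rewrite !ler0_norm ?subr_le0 //; lra.
have [_ s_cc _] := near_t s (lexx _).
have := qu s s_cc; have := qu t t_cc.
have E : u s - u t - (s - t) *: g t =
    (q s - q t - (s - t) *: g t) - (q s - u s) + (q t - u t).
  move: (u s) (u t) (q s) (q t) ((s - t) *: g t) => U U' Q Q' G.
  rewrite opprB [X in _ = X + _]addrC !addrA subrK.
  by rewrite [U - Q' - G + Q']addrAC subrK addrAC.
have : e3 <= e1 / 2 by rewrite ge_min lexx orbT.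
rewrite E.
have := ler_normD (q s - q t - (s - t) *: g t - (q s - u s)) (q t - u t).
have := ler_normB (q s - q t - (s - t) *: g t) (q s - u s).
lra.
Qed.

End UniformLimit.

(** * Smooth dependence of the flow on the parameter *)

Section Flow.
Context (R : realType).

(** Derivatives are required in the open interval only: the variation arises as a limit controlled
    on [[0, T]], which gives no two-sided derivative at the endpoints. *)
Definition solves (V : normedModType R) (T : R) (Om : set (R * V))
    (f : R * V -> V) (w : R -> V) := [/\ {within `[0, T], continuous w},
  (forall t : R, t \in `[0, T] -> Om (t, w t)) &
  (forall t : R, t \in `]0, T[ -> is_derive t (1 : R) w (f (t, w t)))].

(** At the infimum of the exit times the hypothesis still yields the bound, and continuity extends
    it to the right, a contradiction. For [s = 0] the premise is vacuous, so the hypothesis contains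
    the initial bound. *)
Lemma first_exit (V : normedModType R) (T r : R) (w : R -> V) :
  {within `[0, T], continuous w} ->
  (forall s : R, s \in `[0, T] ->
    (forall t : R, t \in `[0, s[ -> `|w t| < r) -> `|w s| < r) ->
  forall t : R, t \in `[0, T] -> `|w t| < r.
Proof.
move=> cw Hexit t t_in; rewrite ltNge; apply/negP => rt.
pose S := [set s : R | s \in `[0, T] /\ r <= `|w s|].
have St : S t by [].
have lbS : lbound S 0 by move=> s [+ _]; rewrite in_itv /= => /andP[].
have infS : has_inf S by split; [exists t|exists 0].
have s_in : inf S \in `[0, T].
  rewrite in_itv /= lb_le_inf //; last by exists t.
  apply: (@le_trans _ _ t); first by apply: ge_inf => //; exists 0.
  by move: t_in; rewrite in_itv => /andP[].
have ws : `|w (inf S)| < r.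
  apply: Hexit => // u; rewrite in_itv /= => /andP[u0 us].
  rewrite ltNge; apply/negP => ru.
  move: (us); apply/negP; rewrite -leNgt; apply: ge_inf; first by exists 0.
  split=> //; rewrite in_itv /= u0 /=.
  apply: le_trans (ltW us) _; by move: s_in; rewrite in_itv => /andP[].
have rws : 0 < r - `|w (inf S)| by rewrite subr_gt0.
have /within_normP/(_ _ s_in _ rws)[d d0 Hd] := cw.
have [u [u_in ru] ud] := inf_adherent d0 infS.
have su : inf S <= u by apply: ge_inf => //; exists 0.
have := Hd u u_in; rewrite ger0_norm ?subr_ge0 // ltrBlDl => /(_ ud).
by have := lerB_dist (w u) (w (inf S)); lra.
Qed.

Context (V E : normedModType R) (C : sup_coords V) (T : R) (Om : set (R * V))
  (f : R * V -> V) (X : set E) (y : E -> R -> V) (L : {linear E -> V}).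
Hypotheses (T0 : 0 <= T) (oOm : open Om) (Cf : C0k Om 1 f) (oX : open X)
  (cL : continuous L) (ysol : forall x, X x -> solves T Om f (y x))
  (yL : forall p q, X p -> X q -> y p 0 - y q 0 = L (p - q)).

Local Notation Df t p := ('d (fun h : V => f (t, h)) p).

Lemma flow_lipschitz x : X x -> exists2 M : R, 0 < M &
  forall r : R, 0 < r -> exists2 d : R, 0 < d & forall p, `|p - x| < d ->
    [/\ X p, (forall t : R, t \in `[0, T] -> `|y p t - y x t| < r) &
      forall q, `|q - x| < d -> forall t : R, t \in `[0, T] ->
        `|y p t - y q t| <= M * `|p - q|].
Proof.
move=> Xx; have [cx Ox Dx] := ysol Xx.
have [K K0 HK] := diff_bounded T0 cx Ox C Cf.
have [d1 d10 Hd1] := strict_diff oOm cx Ox C Cf ltr01.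
have [KL KL0 HL] := (linear_continuous_bound L).1 cL.
have K1 : 0 < K + 1 by rewrite ltr_wpDr.
(* Gronwall's constant for the rate [K + 1] ([K] for the differential along [y x], 1 for the
   remainder from [strict_diff]), times the bound [KL] of [L] on initial increments. *)
pose M := 2 * expR (2 * (K + 1) * T) * KL.
have M0 : 0 < M by rewrite !mulr_gt0 // expR_gt0.
exists M => // r r0.
have nX : nbhs x X by exact: open_nbhs_nbhs.
have [dX dX0 HX] := (near_normP x X).1 nX.
pose r1 := Num.min r d1.
have r10 : 0 < r1 by rewrite lt_min r0 d10.
have gron p q (s : R) : X p -> X q -> s \in `[0, T] ->
    (forall t : R, t \in `[0, s[ -> `|y p t - y x t| < r1) ->
    (forall t : R, t \in `[0, s[ -> `|y q t - y x t| < r1) ->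
    `|y p s - y q s| <= M * `|p - q|.
  move=> Xp Xq s_in Hp Hq.
  have [cp Op Dp] := ysol Xp; have [cq Oq Dq] := ysol Xq.
  have /andP[s0 sT] : 0 <= s <= T by rewrite in_itv in s_in.
  pose w : R -> V := y p - y q.
  have cT : {within `[0, T], continuous w}.
    by move=> t; apply: cvgB; [exact: cp|exact: cq].
  have cw : {within `[0, s], continuous w}.
    apply: continuous_subspaceW cT => t /=.
    by rewrite !in_itv /= => /andP[-> /le_trans->].
  have Dw (t : R) : t \in `]0, s[ -> is_derive t (1 : R) w
      ((fun t => f (t, y p t) - f (t, y q t)) t).
    rewrite in_itv /= => /andP[t0 ts].
    have t_in : t \in `]0, T[ by rewrite in_itv /= t0 (lt_le_trans ts).
    by apply: is_deriveB; [exact: Dp|exact: Dq].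
  have := gronwall C s0 K1 (lexx 0) cw Dw _ (_ : s \in `[0, s]).
  rewrite in_itv /= s0 lexx mul0r addr0 /w !fctE /= => H.
  apply: le_trans (H _ isT) _.
    move=> t; rewrite in_itv /= => /andP[t0 ts].
    have t_in : t \in `[0, T] by rewrite in_itv /= (ltW t0) (ltW (lt_le_trans ts sT)).
    have t_in' : t \in `[0, s[ by rewrite in_itv /= (ltW t0) ts.
    have /andP[_ pd] : (`|y p t - y x t| < r) && (`|y p t - y x t| < d1).
      by rewrite -lt_min; exact: Hp.
    have /andP[_ qd] : (`|y q t - y x t| < r) && (`|y q t - y x t| < d1).
      by rewrite -lt_min; exact: Hq.
    have := Hd1 t t_in _ _ pd qd; have := HK t t_in (y p t - y q t).
    set D := Df _ _ _ => H1 H2.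
    have := lerB_dist (f (t, y p t) - f (t, y q t)) D; lra.
  rewrite yL // /M -[leRHS]mulrA; apply: ler_pM => //.
  rewrite ler_pM2l // ler_expR ler_wpM2l // mulr_ge0 // ltW //.
exists (Num.min dX (r1 / M)); first by rewrite lt_min dX0 divr_gt0.
have HXd p : `|p - x| < Num.min dX (r1 / M) -> X p.
  by rewrite lt_min => /andP[pX _]; exact: HX.
have tub p : `|p - x| < Num.min dX (r1 / M) ->
    forall t : R, t \in `[0, T] -> `|y p t - y x t| < r1.
  move=> pd; have Xp := HXd p pd; have [cp Op Dp] := ysol Xp.
  apply: (@first_exit V T r1 (y p - y x)).
    by move=> t; apply: cvgB; [exact: cp|exact: cx].
  move=> s s_in Hs; apply: le_lt_trans (gron p x s Xp Xx s_in Hs _) _.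
    by move=> t _; rewrite subrr normr0.
  by move: pd; rewrite lt_min => /andP[_]; rewrite ltr_pdivlMr // mulrC.
move=> p pd; split; first exact: HXd.
  by move=> t t_in; have := tub p pd t t_in; rewrite lt_min => /andP[].
move=> q qd t t_in; apply: gron => //; try exact: HXd.
- move=> s; rewrite in_itv /= => /andP[s0 st]; apply: tub => //.
  rewrite in_itv /= s0 /=; move: t_in; rewrite in_itv /= => /andP[_ tT].
  exact: le_trans (ltW st) tT.
- move=> s; rewrite in_itv /= => /andP[s0 st]; apply: tub => //.
  rewrite in_itv /= s0 /=; move: t_in; rewrite in_itv /= => /andP[_ tT].
  exact: le_trans (ltW st) tT.
Qed.

(** The combination [z] vanishes at time 0 because [L] is linear. Its derivative is [Df] applied to
    [z] plus two remainders, each at most [e1 * M * |p - q|], so Gronwall's lemma applies with this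
    inhomogeneity. *)
Lemma flow_collinear_approx x (e : R) : X x -> 0 < e ->
  exists2 d : R, 0 < d & forall t : R, t \in `[0, T] ->
    collinear_approx (y ^~ t) x e d.
Proof.
move=> Xx e0; have [cx Ox Dx] := ysol Xx.
have [K K0 HK] := diff_bounded T0 cx Ox C Cf.
have [M M0 HM] := flow_lipschitz Xx.
pose G := 2 * expR (2 * K * T).
have G0 : 0 < G by rewrite mulr_gt0 // expR_gt0.
have T1 : 0 < T + 1 by rewrite ltr_wpDl.
(* Chosen so that the Gronwall bound becomes [e * |p - q| * (T / (T + 1))]; [T + 1] replaces [T],
   which may be 0. *)
pose e1 := e / (G * 2 * M * (T + 1)).
have e10 : 0 < e1 by rewrite /e1 divr_gt0 // !mulr_gt0 // expR_gt0.
have [d1 d10 Hd1] := strict_diff oOm cx Ox C Cf e10.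
have [d d0 Hd] := HM d1 d10.
exists d => // t t_in p q p' q' a pd qd p'd q'd pq.
have [Xp tp Lp] := Hd p pd; have [Xq tq _] := Hd q qd.
have [Xp' tp' Lp'] := Hd p' p'd; have [Xq' tq' _] := Hd q' q'd.
have [cp Op Dp] := ysol Xp; have [cq Oq Dq] := ysol Xq.
have [cp' Op' Dp'] := ysol Xp'; have [cq' Oq' Dq'] := ysol Xq'.
pose z := (y p - y q) - a *: (y p' - y q').
pose dz s := (f (s, y p s) - f (s, y q s)) - a *: (f (s, y p' s) - f (s, y q' s)).
have cz : {within `[0, T], continuous z}.
  move=> s; apply: cvgB; first by apply: cvgB; [exact: cp|exact: cq].
  by apply: cvgZl_tmp; apply: cvgB; [exact: cp'|exact: cq'].
have Dz (s : R) : s \in `]0, T[ -> is_derive s (1 : R) z (dz s).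
  move=> s_in; apply: is_deriveB.
    by apply: is_deriveB; [exact: Dp|exact: Dq].
  by apply: is_deriveZ; apply: is_deriveB; [exact: Dp'|exact: Dq'].
have eta0 : 0 <= 2 * e1 * M * `|p - q|.
  by apply: mulr_ge0 => //; apply: mulr_ge0; [apply: mulr_ge0 => //|]; exact: ltW.
have dz_le (s : R) : s \in `]0, T[ -> `|dz s| <= K * `|z s| + 2 * e1 * M * `|p - q|.
  move=> /subset_itv_oo_cc s_in.
  have H1 := Hd1 s s_in _ _ (tp s s_in) (tq s s_in).
  have H2 := Hd1 s s_in _ _ (tp' s s_in) (tq' s s_in).
  have H3 := ler_wpM2l (ltW e10) (Lp q qd s s_in).
  have H4 := ler_wpM2l (ltW e10) (Lp' q' q'd s s_in).
  set r1 := _ - Df _ _ _ in H1; set r2 := _ - Df _ _ _ in H2.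
  have -> : dz s = Df s (y x s) (z s) + r1 - a *: r2.
    have -> : Df s (y x s) (z s) = Df s (y x s) (y p s - y q s) -
        a *: Df s (y x s) (y p' s - y q' s) by rewrite -linearZ -linearB.
    rewrite /dz /r1 /r2; move: (Df s (y x s) _) (Df s (y x s) _) => D D'.
    by rewrite [X in _ = X - _]addrC addrA subrK [in RHS]scalerBr opprB addrA subrK.
  apply: le_trans (ler_normB _ _) _.
  have := ler_normD (Df s (y x s) (z s)) r1; have := HK s s_in (z s).
  have H5 : `|a *: r2| <= e1 * (M * `|p - q|).
    rewrite pq !normrZ.
    have -> : e1 * (M * (`|a| * `|p' - q'|)) = `|a| * (e1 * (M * `|p' - q'|)) by ring.
    by apply: ler_wpM2l => //; exact: le_trans H2 H4.
  have := le_trans H1 H3; lra.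
have := gronwall C T0 K0 eta0 cz Dz dz_le t_in.
have -> : z 0 = 0.
  by rewrite /z !fctE /= !yL // -linearZ -pq subrr.
rewrite normr0 add0r -/G => H; apply: le_trans H _.
have -> : G * (2 * e1 * M * `|p - q| * T) = e * `|p - q| * (T / (T + 1)).
  by rewrite /e1; field; rewrite !gt_eqF.
by apply: ler_piMr; [rewrite mulr_ge0 // ltW|rewrite ler_pdivrMr // mul1r lerDl].
Qed.

Lemma flow_differentiable (t : R) x : t \in `[0, T] -> X x ->
  differentiable (y ^~ t) x.
Proof.
move=> t_in Xx; have [M M0 HM] := flow_lipschitz Xx.
have [d d0 Hd] := HM 1 ltr01.
apply: (collinear_approx_differentiable C _ d0 (M := M)).
  by move=> e e0; have [r r0 Hr] := flow_collinear_approx Xx e0; exists r => //; exact: Hr.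
move=> p pd; have [_ _ Lp] := Hd p pd; apply: Lp => //.
by rewrite subrr normr0.
Qed.

Lemma flow_derivative_continuous (t : R) x v : t \in `[0, T] -> X x ->
  {for x, continuous (fun x' => 'd (y ^~ t) x' v)}.
Proof.
move=> t_in Xx; apply: (collinear_approx_continuous oX) => // [e e0|x' Xx'].
  by have [r r0 Hr] := flow_collinear_approx Xx e0; exists r => //; exact: Hr.
exact: flow_differentiable.
Qed.

Lemma flow_derivative0 x v : X x -> 'd (y ^~ 0) x v = L v.
Proof.
move=> Xx; have nX : nbhs x X by exact: open_nbhs_nbhs.
have [d d0 Hd] := (near_normP x X).1 nX.
have [|_ ->] // := diff_normI cL (F := y ^~ 0) (x := x).
move=> e e0; exists d => // p pd.
by rewrite yL ?subrr ?normr0 ?mulr_ge0 // ?ltW //; exact: Hd.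
Qed.

(** The radius in [flow_collinear_approx] does not depend on time, so one step [s] serves all of
    [[0, T]]: the quotients converge uniformly to [u], and their derivatives, by [strict_diff],
    uniformly to [A t (u t)]. *)
Lemma flow_variation x v : X x ->
  solves T [set z : R * (V * V) | Om (z.1, z.2.1)] (augmented f)
    (fun t => (y x t, 'd (y ^~ t) x v)).
Proof.
move=> Xx; have [cx Ox Dx] := ysol Xx.
pose u t := 'd (y ^~ t) x v; rewrite -/(u _).
pose A t : {linear V -> V} := Df t (y x t).
have [K K0 HK] := diff_bounded T0 cx Ox C Cf.
have [M M0 HM] := flow_lipschitz Xx.
have v1 : 0 < `|v| + 1 by rewrite ltr_wpDl.
have KM1 : 0 < 1 + K + M by rewrite !addr_gt0.
have quot (e : R) : 0 < e -> exists q dq : R -> V, [/\ {within `[0, T], continuous q},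
    forall t : R, t \in `]0, T[ -> is_derive t (1 : R) q (dq t),
    forall t : R, t \in `[0, T] -> `|q t - u t| <= e &
    forall t : R, t \in `]0, T[ -> `|dq t - A t (u t)| <= e].
  (* In [1 + K + M], the 1 pays for [q - u], [K] for [A t] applied to it, and [M] for linearising
     [f] at [y x t]. *)
  move=> e0; pose e1 := e / ((1 + K + M) * (`|v| + 1)).
  have e10 : 0 < e1 by rewrite divr_gt0 // mulr_gt0.
  have e1E : (1 + K + M) * (e1 * (`|v| + 1)) = e.
    by rewrite /e1; field; rewrite !gt_eqF.
  have [d1 d10 H1] := flow_collinear_approx Xx e10.
  have [d2 d20 H2] := strict_diff oOm cx Ox C Cf e10.
  have [d3 d30 H3] := HM d2 d20.
  near (0 : R)^'+ => s.
  have s0 : 0 < s by near: s; exact: nbhs_right_gt.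
  have sd1 : `|s *: v| < d1 by near: s; exact: near_scale.
  have sd3 : `|s *: v| < d3 by near: s; exact: near_scale.
  have xx3 : `|x - x| < d3 by rewrite subrr normr0.
  have xx1 : `|x - x| < d1 by rewrite subrr normr0.
  pose p := s *: v + x; have px : p - x = s *: v by rewrite /p addrK.
  rewrite -px in sd1 sd3.
  have [Xp tp Lp] := H3 p sd3; have [cp Op Dp] := ysol Xp.
  have sZ (w : V) (c : R) : `|w| <= c * s -> `|s^-1 *: w| <= c.
    by move=> H; rewrite normrZ gtr0_norm ?invr_gt0 // mulrC ler_pdivrMr.
  have qu t : t \in `[0, T] -> `|s^-1 *: (y p t - y x t) - u t| <= e1 * `|v|.
    move=> t_in; have -> : s^-1 *: (y p t - y x t) - u t =
        s^-1 *: (y p t - y x t - 'd (y ^~ t) x (p - x)).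
      rewrite px linearZ /= [RHS]scalerBr scalerA mulVf ?gt_eqF // scale1r //.
    apply: sZ; have -> : e1 * `|v| * s = e1 * `|p - x|.
      by rewrite px normrZ gtr0_norm // mulrAC mulrA.
    exact: (collinear_approx_diff (H1 t t_in) (flow_differentiable t_in Xx) xx1 sd1 xx1).
  have ev : e1 * `|v| <= e1 * (`|v| + 1) by rewrite ler_pM2l // lerDl.
  exists (fun t => s^-1 *: (y p t - y x t)),
    (fun t => s^-1 *: (f (t, y p t) - f (t, y x t))); split.
  - by move=> t; apply: cvgZl_tmp; apply: cvgB; [exact: cp|exact: cx].
  - by move=> t t_in; apply: is_deriveZ; apply: is_deriveB; [exact: Dp|exact: Dx].
  - move=> t t_in; apply: le_trans (qu t t_in) _; rewrite -e1E.
    have := mulr_ge0 (ltW K0) (le_trans (mulr_ge0 (ltW e10) (normr_ge0 v)) ev).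
    have := mulr_ge0 (ltW M0) (le_trans (mulr_ge0 (ltW e10) (normr_ge0 v)) ev).
    lra.
  - move=> t /subset_itv_oo_cc t_in.
    have xt : `|y x t - y x t| < d2 by rewrite subrr normr0.
    have := H2 t t_in _ _ (tp t t_in) xt => Hf.
    have {}Hf : `|s^-1 *: (f (t, y p t) - f (t, y x t)) -
        A t (s^-1 *: (y p t - y x t))| <= M * (e1 * `|v|).
      rewrite [A t _]linearZ /= -scalerBr; apply: sZ; apply: le_trans Hf _.
      have := Lp x xx3 t t_in; rewrite px normrZ gtr0_norm // => Hl.
      have := ler_wpM2l (ltW e10) Hl; lra.
    have := HK t t_in (s^-1 *: (y p t - y x t) - u t).
    rewrite linearB /= -/(A t) => HA.
    have := ler_wpM2l (ltW K0) (le_trans (qu t t_in) ev).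
    have := ler_wpM2l (ltW M0) ev.
    have := ler_distD (A t (s^-1 *: (y p t - y x t)))
      (s^-1 *: (f (t, y p t) - f (t, y x t))) (A t (u t)).
    have := mulr_ge0 (ltW e10) (ltW v1).
    rewrite -e1E; lra.
have cu : {within `[0, T], continuous u}.
  apply: uniform_approx_continuous => e /quot[q [dq [cq _ qu _]]].
  by exists q.
have cxu : {within `[0, T], continuous (fun t => (y x t, u t))}.
  by move=> t; apply: cvg_pair; [exact: cx|exact: cu].
have oOm' := open_fst_slice oOm.
have caug z : Om (z.1, z.2.1) -> {for z, continuous (augmented f)}.
  exact: C0k_continuous (C0k_augmented C oOm Cf).
(* Continuity of [A t (u t)] is read off from the augmented field along the continuous curve
   [(y x, u)]. *)
have cAu : {within `[0, T], continuous (fun t => A t (u t))}.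
  have := @continuous_trajectory R (V * V)%type T _ _ cxu Ox _ _ caug.
  have csnd : continuous (snd : V * V -> V) by move=> z; exact: cvg_snd.
  exact: (@within_linear R (V * V)%type V snd _ _ csnd).
have Du t : t \in `]0, T[ -> is_derive t (1 : R) u (A t (u t)).
  apply: (@uniform_approx_derive _ _ C T u (fun t => A t (u t))) => // e.
  by move=> /quot[q [dq [_ Dq qu dqu]]]; exists q, dq.
split=> // t t_in; rewrite /augmented /=.
have /is_derive_normP Hx := Dx t t_in; have /is_derive_normP Hu := Du t t_in.
apply/is_derive_normP => e e0.
have [r1 r10 Hr1] := Hx e e0; have [r2 r20 Hr2] := Hu e e0.
exists (Num.min r1 r2); first by rewrite lt_min r10 r20.
move=> s; rewrite lt_min => /andP[sr1 sr2].
by rewrite prod_normE /= ge_max Hr1 // Hr2.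
Unshelve. all: by end_near. Qed.

End Flow.

Lemma C0kW (R : realType) (V W : normedModType R) (Om : set (R * V)) k
    (f : R * V -> W) : C0k Om k.+1 f -> C0k Om 1 f.
Proof. by elim: k => // k IHk /C0k_pred. Qed.

(** The induction quantifies over the state space and all that lives on it, because its step
    replaces [V] by [V * V]; the directional derivative is the second projection of the map supplied
    by the induction hypothesis. *)
Lemma flow_Ck (R : realType) (E : normedModType R) (T : R) (X : set E) k
    (V : normedModType R) (C : sup_coords V) (Om : set (R * V)) (f : R * V -> V)
    (y : E -> R -> V) (L : {linear E -> V}) :
  0 <= T -> open X -> open Om -> C0k Om k.+1 f -> continuous L ->
  (forall x, X x -> solves T Om f (y x)) ->
  (forall p q, X p -> X q -> y p 0 - y q 0 = L (p - q)) ->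
  forall t : R, t \in `[0, T] -> Ck X k.+1 (y ^~ t).
Proof.
move=> T0 oX; elim: k V C Om f y L => [|k IHk] V C Om f y L oOm Cf cL ysol yL t t_in.
  split=> [x Xx|v x Xx]; first exact: (flow_differentiable C T0 oOm Cf oX cL ysol yL).
  exact: (flow_derivative_continuous C T0 oOm Cf oX cL ysol yL).
have Cf1 := C0kW Cf.
split=> [x Xx|v]; first exact: (flow_differentiable C T0 oOm Cf1 oX cL ysol yL).
(* By [flow_derivative0] the initial variation is [L v] for every [x], so it cancels in differences:
   hence the component 0. *)
have [L' L'E] : exists L' : {linear E -> (V * V)%type},
    L' = (fun x => (L x, 0)) :> (E -> V * V).
  apply: (@linear_pack R E (V * V)%type) => a p q.
  by congr (_, _); rewrite /= ?linearP ?scaler0 ?addr0.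
have cL' : continuous L'.
  have [K K0 HK] := (linear_continuous_bound L).1 cL.
  apply/linear_continuous_bound; exists K => // p.
  by rewrite L'E prod_normE /= normr0 ge_max HK mulr_ge0 // ltW.
have CkZ : Ck X k.+1 (fun x => (y x t, 'd (y ^~ t) x v)).
  apply: (IHk (V * V)%type (sup_coords_prod C C)
    [set z : R * (V * V) | Om (z.1, z.2.1)] (augmented f)
    (fun x t => (y x t, 'd (y ^~ t) x v)) L') => //.
  - exact: open_fst_slice.
  - exact: C0k_augmented.
  - by move=> x Xx; exact: (flow_variation C T0 oOm Cf1 oX cL ysol yL).
  - move=> p q Xp Xq; rewrite L'E -yL //.
    rewrite !(flow_derivative0 oX cL yL) //.
    by congr (_, _); rewrite /= subrr.
have csnd : continuous (snd : V * V -> V) by move=> z; exact: cvg_snd.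
exact: (@Ck_linear R E (V * V)%type V X k.+1 _ snd oX csnd CkZ).
Qed.

(** * Neural ODEs: regularity, invariant direction, kernel of the Hessian *)

Section NeuralODE.
Context (R : realType).

Lemma sup_coords_cV n : sup_coords 'cV[R]_n.
Proof.
have lin i : exists l : {linear 'cV[R]_n -> R}, l = (fun v => v i 0) :> ('cV[R]_n -> R).
  by apply: linear_pack => a v w; rewrite !mxE.
pose crd i := sval (cid (lin i)).
have crdE i v : crd i v = v i 0 by rewrite /crd; case: cid => l /= ->.
apply: (@SupCoords _ _ _ crd (fun i => delta_mx i 0)) => [v|i v|v M M0 H].
- rewrite {1}[v]matrix_sum_delta; apply: eq_bigr => i _.
  by rewrite big_ord1 crdE.
- rewrite crdE [leRHS]mx_normrE.
  exact: (le_bigmax _ (fun ij => `|v ij.1 ij.2|) (i, 0)).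
- rewrite [leLHS]mx_normrE; apply: bigmax_le => // -[i j] _ /=.
  by have := H i; rewrite crdE ord1.
Qed.

Lemma mulmx_linear_continuous m n (W : 'M[R]_(m, n)) :
  exists2 L : {linear 'cV[R]_n -> 'cV[R]_m}, continuous L & forall x, L x = W *m x.
Proof.
have [L LE] : exists L : {linear 'cV[R]_n -> 'cV[R]_m},
    L = (fun x => W *m x) :> ('cV[R]_n -> 'cV[R]_m).
  by apply: linear_pack => a v w; rewrite mulmxDr scalemxAr.
exists L => [|x]; last by rewrite LE.
apply/linear_continuous_bound.
exists (\sum_i `|L (sc_vec (sup_coords_cV n) i)| + 1).
  by rewrite ltr_wpDl // sumr_ge0.
move=> v; apply: le_trans (sum_coord_bound (sup_coords_cV n) L v) _.
by apply: ler_wpM2r => //; rewrite lerDl.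
Qed.

Lemma Ck_shift (V W : normedModType R) (U : set V) k (F : V -> W) (c : W) :
  open U -> Ck U k F -> Ck U k (fun x => F x + c).
Proof.
move=> oU; case: k => [|k] /=.
  by move=> cF x Ux; apply: continuousD; [exact: cF|exact: cst_continuous].
move=> [dF cdF]; have D x : U x -> is_diff x (F + cst c) ('d F x).
  move=> Ux; have dFx := dF x Ux; rewrite -[('d F x : V -> W)]addr0.
  exact: (is_diffD (differentiableP dFx) (is_diff_cst c x)).
split=> [x /D []//|v]; apply: Ck_eq (cdF v) => // x /D dx.
by rewrite (diff_val (is_diff_def := dx)).
Qed.

Lemma solves_ivp m (T : R) (Ot : set R) (Oh : set 'cV[R]_m)
    (f : R * 'cV[R]_m -> 'cV[R]_m) a I h :
  ivp_solution Ot Oh f a I h -> `[0, T]%classic `<=` I ->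
  solves T (Ot `*` Oh) f h.
Proof.
move=> [[_ _ _ IOt _] Ih] sub; split.
- apply/subspace_continuousP => t t_in; apply: cvg_within_filter.
  apply: differentiable_continuous; apply/derivable1_diffP.
  by have [_ []] := Ih t (sub t t_in).
- by move=> t t_in; have [Oht _] := Ih t (sub t t_in); split=> //; exact/IOt/sub.
- by move=> t /subset_itv_oo_cc t_in; have [] := Ih t (sub t t_in).
Qed.

Lemma node_Ck k (T : R) n m (X : set 'cV[R]_n) (Ot : set R) (Oh : set 'cV[R]_m)
    (f : R * 'cV[R]_m -> 'cV[R]_m) (W : 'M[R]_(m, n)) b (Wt : 'M[R]_(1, m)) bt Phi :
  0 <= T -> open X -> node_repr k.+1 T X Ot Oh f W b Wt bt Phi -> Ck X k.+1 Phi.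
Proof.
move=> T0 oX [oOt oOh Cf XOh [Ia [h Hh]]].
have oOm : open (Ot `*` Oh).
  rewrite openE => -[t p] [/= Ot_t Oh_p].
  by exists (Ot, Oh); [split; exact: open_nbhs_nbhs|].
have [L cL LE] := mulmx_linear_continuous W.
have [M cM ME] := mulmx_linear_continuous Wt.
pose y x := h (W *m x + b).
have ysol x : X x -> solves T (Ot `*` Oh) f (y x).
  by move=> /Hh[[sol _] sub _]; exact: solves_ivp sol sub.
have yL p q : X p -> X q -> y p 0 - y q 0 = L (p - q).
  move=> /Hh[[[[_ _ _ _ hp] _] _] _ _] /Hh[[[[_ _ _ _ hq] _] _] _ _].
  by rewrite /y hp hq LE mulmxBr opprD addrACA subrr addr0.
have T_in : T \in `[0, T] by rewrite in_itv /= T0 lexx.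
have CkT := flow_Ck (sup_coords_cV m) T0 oX oOm Cf cL ysol yL T_in.
have [N [cN NE]] : exists N : {linear 'cV[R]_m -> R},
    continuous N /\ N = (fun z => (Wt *m z) 0 0) :> ('cV[R]_m -> R).
  have [N NE] : exists N : {linear 'cV[R]_m -> R}, N = (fun z => (Wt *m z) 0 0) :> (_ -> _).
    by apply: linear_pack => a v w; rewrite mulmxDr -scalemxAr !mxE.
  exists N; split=> //; have [K K0 HK] := (linear_continuous_bound M).1 cM.
  apply/linear_continuous_bound; exists K => // z.
  apply: le_trans (HK z); rewrite NE ME [leRHS]mx_normrE.
  exact: (le_bigmax _ (fun ij => `|(Wt *m z) ij.1 ij.2|) (0, 0)).
apply: Ck_eq (Ck_shift bt oX (Ck_linear oX cN CkT)) => // x /Hh[_ _ ->].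
by rewrite /= NE.
Qed.

(** The family [h] is indexed by the initial value, so equal values of [W *m x + b] give equal
    outputs. Both points must lie in [X], where [Phi] is given by the formula. *)
Lemma node_degenerate_direction k (T : R) n m (X : set 'cV[R]_n) (Ot : set R)
    (Oh : set 'cV[R]_m) (f : R * 'cV[R]_m -> 'cV[R]_m) (W : 'M[R]_(m, n)) b
    (Wt : 'M[R]_(1, m)) bt Phi :
  (0 < n)%N -> node_repr k T X Ot Oh f W b Wt bt Phi -> degenerate_weights W Wt ->
  exists2 v : 'cV[R]_n, v != 0 &
    forall x (s : R), X x -> X (s *: v + x) -> Phi (s *: v + x) = Phi x.
Proof.
move=> n0 [_ _ _ _ [Ia [h Hh]]] [rW|/eqP].
  (* In the row-vector convention, the right kernel of [W] is spanned by the columns of [cokermx W],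
     whose rank [n - \rank W] is positive. *)
  have [j vj] : exists j, col j (cokermx W) != 0.
    apply/existsP; rewrite -negb_forall; apply/negP => /forallP H.
    have : \rank (cokermx W) == 0%N.
      rewrite mxrank_eq0; apply/eqP/matrixP => i j.
      by have /eqP/matrixP/(_ i 0) := H j; rewrite !mxE.
    rewrite mxrank_coker subn_eq0 leqNgt.
    by rewrite (leq_trans rW) // geq_minr.
  exists (col j (cokermx W)) => // x s /Hh[_ _ ->] /Hh[_ _ ->].
  have E : W *m col j (cokermx W) = 0.
    by rewrite colE mulmxA mulmx_coker mul0mx.
  by rewrite mulmxDr -scalemxAr E scaler0 add0r.
(* Here [Phi] is the constant [bt] on [X], so any nonzero vector serves; [n0] provides an entry
   showing that this one is nonzero. *)
rewrite mxrank_eq0 => /eqP Wt0; exists (const_mx 1).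
  apply/eqP => /matrixP/(_ (Ordinal n0) 0); rewrite !mxE => /eqP.
  by rewrite oner_eq0.
by move=> x s /Hh[_ _ ->] /Hh[_ _ ->]; rewrite Wt0 !mul0mx.
Qed.

Lemma diff_invariant_direction n (X : set 'cV[R]_n) (Phi : 'cV[R]_n -> R)
    (v x : 'cV[R]_n) : open X -> X x -> differentiable Phi x ->
  (forall s : R, X (s *: v + x) -> Phi (s *: v + x) = Phi x) -> 'd Phi x v = 0.
Proof.
move=> oX Xx dPhi inv; apply/eqP; rewrite -normr_le0.
apply/ler_addgt0Pr => e e0; rewrite add0r.
have v1 : 0 < `|v| + 1 by rewrite ltr_wpDl.
have [d d0 Hd] := (near_normP x X).1 (open_nbhs_nbhs (conj oX Xx)).
have [|r r0 Hr] := diff_normP dPhi (e := e / (`|v| + 1)); first exact: divr_gt0.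
near (0 : R)^'+ => s.
have s0 : 0 < s by near: s; exact: nbhs_right_gt.
have sd : `|s *: v| < d by near: s; exact: near_scale.
have sr : `|s *: v| < r by near: s; exact: near_scale.
have := Hr (s *: v + x); have := Hd (s *: v + x); rewrite addrK.
move=> /(_ sd)/inv -> /(_ sr).
rewrite subrr sub0r normrN linearZ !normrZ gtr0_norm // mulrCA ler_pM2l //.
move=> H; apply: le_trans H _; rewrite mulrAC ler_pdivrMr // ler_pM2l // lerDl.
by [].
Unshelve. all: by end_near. Qed.

(** In [hessian] the row index is the outer derivative, so entry [i] of [hessian Phi x *m v] is the
    [i]-th partial derivative of the sum of the [v j 0 * partial j Phi], that is of ['d Phi _ v],
    which vanishes near [x]. *)
Lemma hessian_kernel k n (X : set 'cV[R]_n) (Phi : 'cV[R]_n -> R)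
    (v x : 'cV[R]_n) : open X -> Ck X k.+2 Phi ->
  (forall x, X x -> 'd Phi x v = 0) -> X x -> hessian Phi x *m v = 0.
Proof.
move=> oX [dPhi cdPhi] dv Xx.
have nX := open_nbhs_nbhs (conj oX Xx).
pose G (j : 'I_n) (z : 'cV[R]_n) : R := 'd Phi z (delta_mx j 0).
have dG j : differentiable (G j) x by have [+ _] := cdPhi (delta_mx j 0); apply.
(* [partial j Phi] and [G j] are known to agree only on [X], where [Phi] is differentiable; openness
   transfers the derivative at [x]. *)
have dP j : differentiable (partial j Phi) x /\
    'd (partial j Phi) x = 'd (G j) x :> ('cV[R]_n -> R).
  apply: near_eq_differentiable (dG j); apply: filterS nX => z Xz.
  by rewrite /partial deriveE //; exact: dPhi.
have S0 z : X z -> 0 = (\sum_(j < n) v j 0 *: G j) z.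
  move=> /dv; rewrite {1}[v]matrix_sum_delta linear_sum => <-.
  rewrite fct_sumE; apply: eq_bigr => j _.
  by rewrite big_ord1 linearZ.
have [dS dSE] : differentiable (\sum_(j < n) v j 0 *: G j) x /\
    'd (\sum_(j < n) v j 0 *: G j) x = 'd (cst (0 : R)) x :> ('cV[R]_n -> R).
  apply: near_eq_differentiable; last exact: differentiable_cst.
  by apply: filterS nX => z Xz; exact: S0.
apply/matrixP => i j; rewrite ord1 !mxE.
have Dsum : is_derive x (delta_mx i 0) (\sum_(j < n) v j 0 *: G j)
    (\sum_(j < n) v j 0 *: 'd (G j) x (delta_mx i 0)).
  apply: is_derive_sum => l; apply: is_deriveZ; split.
    exact: diff_derivable.
  by rewrite deriveE.
have := @derive_val _ _ _ _ _ _ _ Dsum.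
rewrite deriveE // dSE diff_cst => E.
rewrite [RHS]E; apply: eq_bigr => l _; rewrite !mxE mulrC /partial.
by have [dl dlE] := dP l; rewrite -/(partial l Phi) deriveE // dlE.
Qed.

End NeuralODE.

Theorem theorem4p17 (R : realType) (k n : nat) (T : R) (X : set 'cV[R]_n)
  (Phi : 'cV[R]_n -> R) (hk : (2 <= k)%N) (hn : (0 < n)%N) (hT : 0 < T)
  (hX : open X) (hPhi : NODE_D k T X Phi) :
  (forall x, critical_point X Phi x -> degenerate_critical_point X Phi x) /\
  (class_C1 k X Phi \/ class_C3 k X Phi).
Proof.
have [m [Ot [Oh [f [W [b [Wt [bt [_ repr deg]]]]]]]]] := hPhi.
case: k hk repr {hPhi} => [|[|k]] // _ repr.
have CkPhi := node_Ck (ltW hT) hX repr.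
have [dPhi _] := CkPhi.
have [v v0 inv] := node_degenerate_direction hn repr deg.
have dv x : X x -> 'd Phi x v = 0.
  move=> Xx; apply: (diff_invariant_direction hX Xx); first exact: dPhi.
  by move=> s; exact: inv.
have crit x : critical_point X Phi x -> degenerate_critical_point X Phi x.
  move=> cx; split=> //; apply/negP => Hu.
  have := hessian_kernel hX CkPhi dv cx.1.
  move=> /(congr1 (mulmx (invmx (hessian Phi x)))).
  by rewrite mulKmx // mulmx0; apply/eqP.
split=> //; have [[x cx]|nc] := pselect (exists x, critical_point X Phi x).
  by right; split=> //; exists x; exact: crit.
by left; split.
Qed.
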